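(* Let $$B(x,t)=\sum_{\omega\in\mathrm{Cay}_+}x^{|\omega|}t^{\mu(\omega)},\qquad S_{\geq3}(x,y)=\sum_{\substack{\sigma\text{ simple}\\|\sigma|\geq3}}x^{|\sigma|-\mu(\sigma)}y^{\mu(\sigma)},$$ where the second sum is over simple Cayley permutations $\sigma$ of length at least three. Then $$B(x,t)=tx+x^2+\frac{2B(x,t)^2}{1+B(x,t)}+S_{\geq3}\bigl(x,B(x,t)\bigr).$$
   Context: Write $[n]=\{1,\ldots,n\}$. A Cayley permutation of length $n$ is a word $\omega=w_1\cdots w_n$ of positive integers whose set of letters is $[m]$ for some $m\leq n$; equivalently a map $\omega:[n]\to[n]$, $\omega(i)=w_i$, with image $[m]$. $\mathrm{Cay}_n$ is the set of those of length $n$, $\mathrm{Cay}_+=\bigcup_{n\geq1}\mathrm{Cay}_n$, and $|\omega|$ denotes length. For a Cayley permutation $\omega$, $\mu(\omega)=\#\{j:|\omega^{-1}(j)|=1\}$ is the number of singleton fibres (values occurring exactly once). A nonempty interval of positions $I=[a,b]\subseteq[n]$ is an H-interval of $\omega\in\mathrm{Cay}_n$ if there is an interval of values $J=[c,d]$ with $\omega(I)=J$ and $\omega^{-1}(J)=I$. $\omega\in\mathrm{Cay}_n$ is simple if every H-interval of $\omega$ is a singleton or equals $[n]$. The identity is one of formal power series. *)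

(* Defs.v *)
From HB Require Import structures.
From mathcomp Require Import all_boot all_order all_algebra.
From mathcomp Require Import boolp.

Set Implicit Arguments.
Unset Strict Implicit.
Unset Printing Implicit Defensive.

Import GRing.Theory.
Local Open Scope ring_scope.

Record fps (R : Type) := Fps { coef_fps :> nat -> R }.
Arguments Fps {R} _.

Notation "{ 'fps' R }" := (fps R) (format "{ 'fps'  R }") : type_scope.

HB.instance Definition _ (R : Type) := gen_eqMixin {fps R}.
HB.instance Definition _ (R : Type) := gen_choiceMixin {fps R}.

Lemma fpsP (R : Type) (f g : {fps R}) : (forall n, f n = g n) -> f = g.
Proof. by case: f g => [f] [g] /= fg; congr Fps; apply: funext. Qed.

Section Ring.
Variable R : comNzRingType.
Implicit Types f g h : {fps R}.

Definition fps_zero : {fps R} := Fps (fun=> 0).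
Definition fps_opp f : {fps R} := Fps (fun n => - f n).
Definition fps_add f g : {fps R} := Fps (fun n => f n + g n).

Fact fps_addA : associative fps_add.
Proof. by move=> f g h; apply: fpsP => n /=; rewrite addrA. Qed.
Fact fps_addC : commutative fps_add.
Proof. by move=> f g; apply: fpsP => n /=; rewrite addrC. Qed.
Fact fps_add0 : left_id fps_zero fps_add.
Proof. by move=> f; apply: fpsP => n /=; rewrite add0r. Qed.
Fact fps_addN : left_inverse fps_zero fps_opp fps_add.
Proof. by move=> f; apply: fpsP => n /=; rewrite addNr. Qed.

HB.instance Definition _ :=
  GRing.isZmodule.Build {fps R} fps_addA fps_addC fps_add0 fps_addN.

Definition fpsC (c : R) : {fps R} := Fps (fun n => if n == 0%N then c else 0).
Definition fpsX : {fps R} := Fps (fun n => (n == 1%N)%:R).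
Definition fps_mul f g : {fps R} :=
  Fps (fun n => \sum_(i < n.+1) f i * g (n - i)%N).

Let trunc N f : {poly R} := \poly_(i < N) f i.

Let fps_mulE N f g n : (n < N)%N -> fps_mul f g n = (trunc N f * trunc N g)`_n.
Proof.
move=> ltnN; rewrite coefM; apply: eq_bigr => i _; rewrite !coef_poly.
rewrite (leq_ltn_trans (leq_subr i n) ltnN).
by rewrite (leq_ltn_trans _ ltnN) // -ltnS.
Qed.

Fact fps_mulA : associative fps_mul.
Proof.
move=> f g h; apply: fpsP => n.
rewrite !(@fps_mulE n.+1) //.
transitivity ((trunc n.+1 f * (trunc n.+1 g * trunc n.+1 h))`_n).
  rewrite !coefM; apply: eq_bigr => i _; congr (_ * _).
  have lin : (n - i < n.+1)%N by rewrite ltnS leq_subr.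
  by rewrite [LHS]coef_poly lin (fps_mulE _ _ lin).
rewrite mulrA !coefM; apply: eq_bigr => i _; congr (_ * _).
by rewrite [RHS]coef_poly ltn_ord (@fps_mulE n.+1).
Qed.

Fact fps_mulC : commutative fps_mul.
Proof. by move=> f g; apply: fpsP => n; rewrite !(@fps_mulE n.+1) // mulrC. Qed.

Fact fps_mul1 : left_id (fpsC 1) fps_mul.
Proof.
move=> f; apply: fpsP => n /=; rewrite big_ord_recl /= mul1r subn0.
by rewrite big1 ?addr0 // => i _; rewrite mul0r.
Qed.

Fact fps_mulDl : left_distributive fps_mul +%R.
Proof.
move=> f g h; apply: fpsP => n /=.
by rewrite -big_split; apply: eq_bigr => i _; rewrite mulrDl.
Qed.

Fact fps_1neq0 : fpsC 1 != 0.
Proof. by apply/eqP => /(congr1 (fun f : {fps R} => f 0%N))/eqP; rewrite oner_eq0. Qed.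

HB.instance Definition _ := GRing.Zmodule_isComNzRing.Build {fps R}
  fps_mulA fps_mulC fps_mul1 fps_mulDl fps_1neq0.

Lemma coef_fpsD f g n : (f + g) n = f n + g n. Proof. by []. Qed.
Lemma coef_fpsB f g n : (f - g) n = f n - g n. Proof. by []. Qed.
Lemma coef_fpsM f g n : (f * g) n = \sum_(i < n.+1) f i * g (n - i)%N.
Proof. by []. Qed.
Lemma coef_fps1 n : (1 : {fps R}) n = (n == 0%N)%:R.
Proof. by rewrite /= ; case: eqP. Qed.

Lemma coef_fps_sum (I : Type) (r : seq I) (P : pred I) (F : I -> {fps R}) n :
  (\sum_(i <- r | P i) F i) n = \sum_(i <- r | P i) F i n.
Proof. by apply: (big_morph (fun f : {fps R} => f n)). Qed.

Lemma coef_fpsX_lt f k n : f 0%N = 0 -> (n < k)%N -> (f ^+ k) n = 0.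
Proof.
move=> f0; elim: k n => // k IHk n ltnk; rewrite exprS coef_fpsM big1 // => i _.
have [->|i0] := posnP (i : nat); first by rewrite f0 mul0r.
have n0 : (0 < n)%N by apply: leq_trans i0 _; rewrite -ltnS.
have lt_ni : (n - i < n)%N by rewrite ltn_subrL i0 n0.
by rewrite (IHk (n - i)%N) ?mulr0 // (leq_trans lt_ni).
Qed.

(* The substitution F(x, G(x)), where F : {fps {fps R}} is read as the series  *)
(* F(x, y) = \sum_k F_k(x) y^k. This is meaningful when G has no constant      *)
(* term: by coef_fpsX_lt, G^k contributes nothing to x^n when k > n, so        *)
(* cutting the sum over k at n loses nothing.                                  *)
Definition fps_subst (F : {fps {fps R}}) (G : {fps R}) : {fps R} :=
  Fps (fun n => \sum_(k < n.+1) (F k * G ^+ k) n).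

Lemma fps_subst_widen F (G : {fps R}) n N : G 0%N = 0 -> (n < N)%N ->
  fps_subst F G n = \sum_(k < N) (F k * G ^+ k) n.
Proof.
move=> G0 ltnN; rewrite /= (big_ord_widen N (fun k => (F k * G ^+ k) n)) //.
rewrite big_mkcond; apply: eq_bigr => k _; case: ltnP => // ltnk.
rewrite big1 // => i _.
by rewrite (coef_fpsX_lt G0) ?mulr0 // (leq_ltn_trans (leq_subr _ _)).
Qed.

End Ring.

Arguments fpsX {R}.

(* The inverse of c (1 - g), with c a unit and g without constant term, is     *)
(* c^-1 \sum_k g^k.                                                            *)
Section UnitRing.
Variable R : comUnitRingType.
Implicit Types f g : {fps R}.

Definition fps_unit : {pred {fps R}} := [pred f : {fps R} | f 0%N \is a GRing.unit].

Definition fps_inv f : {fps R} :=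
  if f 0%N \is a GRing.unit then
    fpsC (f 0%N)^-1 * fps_subst (Fps (fun=> 1)) (1 - fpsC (f 0%N)^-1 * f)
  else f.

Lemma coef_fpsCM (c : R) f n : (fpsC c * f) n = c * f n.
Proof.
rewrite coef_fpsM big_ord_recl /= subn0 big1 ?addr0 // => i _.
by rewrite mul0r.
Qed.

Fact fps_mulVx : {in fps_unit, left_inverse 1 fps_inv *%R}.
Proof.
move=> f; rewrite inE => uf; rewrite /fps_inv uf.
set g := 1 - _.
have g0 : g 0%N = 0.
  by rewrite coef_fpsB coef_fps1 coef_fpsCM mulVr // subrr.
rewrite mulrAC -[_ * f](subKr 1) -/g mulrC; apply: fpsP => n.
transitivity (((\sum_(k < n.+1) g ^+ k) * (1 - g)) n).
  rewrite !coef_fpsM; apply: eq_bigr => i _; congr (_ * _).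
  rewrite (fps_subst_widen _ g0 (ltn_ord i)) coef_fps_sum.
  apply: eq_bigr => k _; congr (coef_fps _ _).
  exact: mul1r.
rewrite mulrC -[1 - g]opprB mulNr -subrX1 opprB coef_fpsB.
by rewrite (coef_fpsX_lt g0) ?subr0.
Qed.

Fact fps_unitPl f g : g * f = 1 -> fps_unit f.
Proof.
move=> /(congr1 (fun h : {fps R} => h 0%N)) /=.
rewrite big_ord1 => gf1; apply/unitrP; exists (g 0%N).
by split; last rewrite mulrC.
Qed.

Fact fps_inv_out : {in [predC fps_unit], fps_inv =1 id}.
Proof. by move=> f /negPf nuf; rewrite /fps_inv; move: nuf; rewrite inE => ->. Qed.

HB.instance Definition _ := GRing.ComNzRing_hasMulInverse.Build {fps R}
  fps_mulVx fps_unitPl fps_inv_out.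

End UnitRing.

(* Cayley permutations, with positions and values shifted to {0, ..., n-1}.    *)

Definition cayley n (w : {ffun 'I_n -> 'I_n}) : bool :=
  [exists m : 'I_n.+1, w @: [set: 'I_n] == [set j : 'I_n | j < m]%N].

Definition Cay n : {set {ffun 'I_n -> 'I_n}} := [set w | cayley w].

Definition mu n (w : {ffun 'I_n -> 'I_n}) : nat :=
  #|[set j : 'I_n | #|w @^-1: [set j]| == 1%N]|.

Definition itv n (a b : 'I_n) : {set 'I_n} := [set i : 'I_n | a <= i <= b]%N.

Definition H_interval n (w : {ffun 'I_n -> 'I_n}) (I : {set 'I_n}) : bool :=
  [exists a : 'I_n, exists b : 'I_n, (a <= b)%N && (I == itv a b)] &&
  [exists c : 'I_n, exists d : 'I_n,
     (w @: I == itv c d) && (w @^-1: itv c d == I)].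

Definition simple_cay n (w : {ffun 'I_n -> 'I_n}) : bool :=
  (w \in Cay n) &&
  [forall I : {set 'I_n},
     H_interval w I ==> (#|I| == 1%N) || (I == [set: 'I_n])].

(* B(x, t) as an element of Z[t][[x]]; t is 'X and the series variable is x.   *)
Definition B_gf : {fps {poly int}} :=
  Fps (fun n => if (0 < n)%N then \sum_(w in Cay n) 'X^(mu w) else 0).

(* S_{>=3}(x, y), with coefficients in an arbitrary ring; the outer series     *)
(* variable is y and the inner one is x. A simple s contributes to x^a y^b     *)
(* exactly when |s| - mu s = a and mu s = b, which forces |s| = a + b.         *)
Definition S_ge3 (R : comNzRingType) : {fps {fps R}} :=
  Fps (fun b => Fps (fun a =>
    if (3 <= a + b)%N then
      #|[set s : {ffun 'I_(a + b) -> 'I_(a + b)} | simple_cay s & mu s == b]|%:R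
    else 0)).

Lemma B_gf0 : B_gf 0%N = 0.
Proof. by []. Qed.

Lemma unit_1DB : 1 + B_gf \is a GRing.unit.
Proof.
have -> : (1 + B_gf \is a GRing.unit) = ((1 + B_gf) 0%N \is a GRing.unit) by [].
by rewrite coef_fpsD coef_fps1 B_gf0 addr0 unitr1.
Qed.

(* Main.v *)
(* Every Cayley permutation is read as a word and recovered from order          *)
(* comparisons by standardisation. A word w that is neither a direct nor a skew *)
(* sum has pairwise disjoint maximal proper H-intervals: two overlapping ones   *)
(* would either merge or expose w as a sum. Contracting them gives a simple     *)
(* word s, and the contracted blocks sit on the singleton fibres of s; so w is  *)
(* an inflation of s, uniquely when |s| >= 3, since then every proper           *)
(* H-interval of an inflation lies in a single block. Singleton fibres of w are *)
(* those of the blocks, whence S(x, B). A direct (skew) sum has a unique        *)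
(* decomposition whose first summand is not itself one, so its series P         *)
(* satisfies P = (B - P) B. What is left are the words 1 and 11.                *)
Require Import Defs.
From mathcomp Require Import all_boot all_order all_algebra.
From mathcomp Require Import boolp zify.
Set Implicit Arguments.
Unset Strict Implicit.
Unset Printing Implicit Defensive.
Import GRing.Theory.

(** * Standardisation and words of Cayley permutations *)

(** The nonempty Cayley words fall into four disjoint kinds: direct sums, skew sums, indecomposable
    words of length one or two, and longer indecomposable words. The first two are kept apart by
    [dec_excl], the third is listed in [cays_small] and gives tx + x^2.

    The other kinds are counted through one relation: [infl_by w s bs f] says that [w] arises from
    [s] by putting nonempty words [bs] on the singleton letters, with [f] sending positions to
    blocks. A Cayley word [w] is recovered from [s] and [bs] ([ib_inj]), a Cayley word [s] and [bs]
    from [w] and [f] ([ib_det]), inflations exist ([infl_byP]), and the singleton count is additive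
    over the blocks on singletons ([ib_muw]). Each bijection thus reduces to finding [f] and showing
    that [w] forces it.

    For a long indecomposable word, overlapping proper H-intervals merge ([phint_union]), and
    contracting the maximal ones leaves a simple word ([indec_simple]). Conversely, in an inflation
    of a simple word of length at least three, distinct positions share a block exactly when a
    proper H-interval contains both ([simple_phint], [simple_block]), so [f] is forced
    ([simple_uniq]). Each simple [s] contributes x to the number of its non-singleton positions
    times B to the number of its singletons, which sums to S(x, B) by [subst_sum]; [simple_cayE]
    matches the two notions of simplicity.

    For sums, [f] splits at the leftmost cut ([dec_two], [two_uniq]). If P is the series of direct
    sums, or of skew sums, then P = (B - P) B, so P = B^2 / (1 + B) in both cases. *)

Definition rk (s : seq nat) x := count (fun y => y < x) (undup s).
Definition std s := map (rk s) s.
Definition cayw s := std s == s.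

Lemma size_std s : size (std s) = size s.
Proof. exact: size_map. Qed.

Lemma rk_lt s x y : x \in s -> (rk s x < rk s y) = (x < y).
Proof.
move=> xs; case: (ltnP x y) => [ltxy|leyx]; last first.
  by apply/negbTE; rewrite -leqNgt; apply: sub_count => z /=; lia.
rewrite /rk; set u := undup s.
have cx : 0 < count_mem x u by rewrite -has_count has_pred1 mem_undup.
have := count_predUI (fun z => z < x) (pred1 x) u.
have -> : count (predI (fun z => z < x) (pred1 x)) u = 0.
  by apply/eqP; rewrite -leqn0 leqNgt -has_count; apply/hasPn => z _ /=; lia.
have : count (predU (fun z => z < x) (pred1 x)) u <= count (fun z => z < y) u.
  by apply: sub_count => z /=; lia.
move=> le_U; rewrite addn0 => eU; apply: leq_trans le_U.
by rewrite eU -addn1 leq_add2l.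
Qed.

(** Standardisation retains exactly the order pattern. Indexing the letters by a list [B] makes this
    applicable to the restriction of a word to a block. *)
Lemma std_map_eq (T : eqType) (w w' : T -> nat) B :
  std (map w B) = std (map w' B) <-> {in B &, forall x y, (w x < w y) = (w' x < w' y)}.
Proof.
split=> [E x y xB yB|E].
  rewrite -(@rk_lt (map w B)) ?map_f // -(@rk_lt (map w' B) (w' x)) ?map_f //.
  have H z : z \in B -> rk (map w B) (w z) = rk (map w' B) (w' z).
    move: E; rewrite /std -!map_comp => /eq_in_map H; exact: H.
  by rewrite !H.
rewrite /std -!map_comp; apply/eq_in_map => y yB /=; rewrite /rk.
(* The letter at [y] must stay comparable while the induction shortens [B], hence the extra head. *)
have {}E : forall x x', x \in y :: B -> x' \in y :: B -> (w x < w x') = (w' x < w' x').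
  by move=> x x'; rewrite !inE => /orP[/eqP->|?] /orP[/eqP->|?]; apply: E.
clear yB; elim: B E => //= x B IH E.
have sub : {subset y :: B <= y :: x :: B}.
  by move=> z; rewrite !inE => /orP[->|->]; rewrite ?orbT.
have {}IH := IH (fun z z' zB z'B => E z z' (sub z zB) (sub z' z'B)).
have -> : (w x \in map w B) = (w' x \in map w' B).
  apply/mapP/mapP => -[z zB e]; exists z => //;
  have := E x z; have := E z x; rewrite !inE eqxx zB !orbT; lia.
case: ifP => //= _; rewrite IH; congr (nat_of_bool _ + _).
by apply: E; rewrite !inE eqxx ?orbT.
Qed.

Lemma std_id s : std (std s) = std s.
Proof.
rewrite -[in RHS](map_id s) {1}/std; apply/std_map_eq => x y xs _.
exact: rk_lt.
Qed.

Lemma cayw_std s : cayw (std s).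
Proof. by rewrite /cayw std_id. Qed.

Lemma std_lt s x y : x < size s -> y < size s ->
  (nth 0 (std s) x < nth 0 (std s) y) = (nth 0 s x < nth 0 s y).
Proof. by move=> xs ys; rewrite !(nth_map 0) // rk_lt // mem_nth. Qed.

Lemma cayw_inj s s' : cayw s -> cayw s' -> size s = size s' ->
  (forall x y, x < size s -> y < size s ->
     (nth 0 s x < nth 0 s y) = (nth 0 s' x < nth 0 s' y)) -> s = s'.
Proof.
move=> /eqP cs /eqP cs' ss H; rewrite -cs -cs'.
rewrite -[s in LHS](mkseq_nth 0) -[s' in RHS](mkseq_nth 0) -ss /mkseq.
by apply/std_map_eq => x y; rewrite !mem_iota /= !add0n; apply: H.
Qed.

(** Rank and value agree at every letter exactly when no smaller value is skipped. *)
Lemma caywP s : reflect (forall x, x \in s -> forall y, y < x -> y \in s) (cayw s).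
Proof.
apply: (iffP eqP) => [E x xs y yx|H].
  have rkx : rk s x = x.
    by move: E; rewrite -[RHS]map_id => /eq_in_map; apply.
  have := @uniq_min_size _ [seq z <- undup s | z < x] (iota 0 x).
  rewrite filter_uniq ?undup_uniq // => /(_ isT) [].
  - by move=> z; rewrite mem_filter mem_iota => /andP[].
  - by rewrite size_iota size_filter -/(rk s x) rkx.
  by move=> _ /(_ y); rewrite mem_filter mem_iota mem_undup yx /= => ->.
rewrite /std -[RHS]map_id; apply/eq_in_map => x xs.
rewrite /rk -size_filter -[RHS](size_iota 0); apply: perm_size.
apply: uniq_perm; rewrite ?filter_uniq ?undup_uniq ?iota_uniq // => z.
rewrite mem_filter mem_undup mem_iota /= add0n.
by case: ltnP => //= zx; apply: (H x).
Qed.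

Definition word n (w : {ffun 'I_n -> 'I_n}) : seq nat :=
  [seq val (w i) | i <- enum 'I_n].

Lemma size_word n (w : {ffun 'I_n -> 'I_n}) : size (word w) = n.
Proof. by rewrite size_map size_enum_ord. Qed.

Lemma nth_word n (w : {ffun 'I_n -> 'I_n}) (i : 'I_n) : nth 0 (word w) i = w i.
Proof. by rewrite (nth_map i) ?size_enum_ord // nth_ord_enum. Qed.

Lemma word_inj n : injective (@word n).
Proof.
move=> w w' E; apply/ffunP => i; apply: val_inj.
by rewrite /= -!nth_word E.
Qed.

Lemma mem_word n (w : {ffun 'I_n -> 'I_n}) (j : 'I_n) :
  (val j \in word w) = (j \in w @: [set: 'I_n]).
Proof.
apply/mapP/imsetP => -[i _ e]; exists i; rewrite ?mem_enum ?inE //.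
  exact: val_inj.
by rewrite e.
Qed.

Lemma cayleyE n (w : {ffun 'I_n -> 'I_n}) : cayley w = cayw (word w).
Proof.
apply/existsP/caywP => [[m /eqP E] _ /mapP[i _ ->] y yx|H].
  have yn : y < n by apply: ltn_trans yx (ltn_ord _).
  rewrite -[y]/(val (Ordinal yn)) mem_word E inE /=.
  have : w i \in w @: [set: 'I_n] by apply: imset_f; rewrite inE.
  by rewrite E inE => /(ltn_trans yx).
have mn : \max_(i < n) (w i).+1 < n.+1 by rewrite ltnS; apply/bigmax_leqP => i _.
exists (Ordinal mn); apply/eqP/setP => j; rewrite inE /= -mem_word.
apply/idP/idP => [/mapP[i _ /val_inj E]|]; first by rewrite E; apply: (leq_bigmax i).
apply: contraLR => jw; rewrite -leqNgt; apply/bigmax_leqP => i _.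
rewrite ltnNge; apply: contra jw; rewrite leq_eqVlt => /orP[/eqP e|].
  by rewrite [val j]e; apply: map_f; rewrite mem_enum.
by apply: H; apply: map_f; rewrite mem_enum.
Qed.

Definition cays n : seq (seq nat) := [seq word w | w <- enum (Cay n)].

Lemma cays_uniq n : uniq (cays n).
Proof. by rewrite map_inj_uniq ?enum_uniq //; apply: word_inj. Qed.

Lemma mem_cays n s : (s \in cays n) = (size s == n) && cayw s.
Proof.
apply/mapP/andP => [[w]|[/eqP ss cs]].
  by rewrite mem_enum inE => cw ->; rewrite size_word eqxx -cayleyE.
have sn i : i < n -> nth 0 s i < n.
  move=> lin; rewrite -(eqP cs) (nth_map 0) ?ss //.
  (* The rank of a letter does not count that letter, so it stays below the number of distinct
     letters. *)
  apply: leq_trans (_ : size (undup s) <= n); last by rewrite -ss size_undup.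
  rewrite ltn_neqAle count_size andbT -all_count; apply/negP => /allP.
  by move=> /(_ (nth 0 s i)); rewrite mem_undup mem_nth ?ss // ltnn => /(_ isT).
pose w := [ffun i : 'I_n => Ordinal (sn i (ltn_ord i))].
have ws : s = word w.
  apply: (@eq_from_nth _ 0) => [|i]; rewrite ?size_word // ss => lin.
  by rewrite -[i]/(val (Ordinal lin)) nth_word ffunE.
by exists w => //; rewrite mem_enum inE cayleyE -ws.
Qed.

(** Singleton fibres are represented by their unique position instead of their value. *)
Definition sing s p := `[< forall q, q < size s -> nth 0 s q = nth 0 s p -> q = p >].
Definition muw s := count (sing s) (iota 0 (size s)).

Lemma muw_word n (w : {ffun 'I_n -> 'I_n}) : muw (word w) = mu w.
Proof.
rewrite /muw size_word -val_enum_ord count_map /mu.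
rewrite cardsE -sum1_card -sum1_count big_enum_cond /=.
(* Each singleton value is replaced by the one position in its fibre, so that exchanging the sums
   counts positions. *)
rewrite [RHS](eq_bigr (fun j => \sum_(i | w i == j) 1)); last first.
  move=> j /eqP e; rewrite -[LHS]e -sum1_card; apply: eq_bigl => i.
  by rewrite !inE.
rewrite (exchange_big_dep xpredT) //= big_mkcond; apply: eq_bigr => i _.
rewrite (eq_bigl (fun j => (j == w i) && (#|w @^-1: [set w i]| == 1))); last first.
  by move=> j; rewrite andbC; case: eqVneq => [->|] //=; rewrite ?eqxx // eq_sym => /negPf->.
rewrite big_mkcondr big_pred1_eq.
have -> : sing (word w) i = (#|w @^-1: [set w i]| == 1) => //.
apply/asboolP/cards1P => [H|[k /setP E] q].
  exists i; apply/setP => q; rewrite !inE; apply/eqP/eqP => [e|->//].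
  by apply/val_inj/H; rewrite ?size_word ?ltn_ord // !nth_word e.
rewrite size_word => qn; rewrite -[q]/(val (Ordinal qn)) !nth_word => /val_inj e.
have := E i; have := E (Ordinal qn); rewrite !inE e eqxx.
by move=> /esym/eqP <- /esym/eqP <-.
Qed.

(** * Inflations *)

Definition blk (f : nat -> nat) n p := [seq x <- iota 0 n | f x == p].

Lemma mem_blk f n p x : (x \in blk f n p) = (x < n) && (f x == p).
Proof. by rewrite mem_filter mem_iota andbC. Qed.

Lemma blk_uniq f n p : uniq (blk f n p).
Proof. by rewrite filter_uniq ?iota_uniq. Qed.

Lemma eq_blk f f' n p : (forall x, x < n -> f x = f' x) -> blk f n p = blk f' n p.
Proof. by move=> E; apply: eq_in_filter => x; rewrite mem_iota => /= /E ->. Qed.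

Definition blk_std (w : seq nat) f p := std (map (nth 0 w) (blk f (size w) p)).

(* [w] is the inflation of [s] by the blocks [bs], where [f] sends each        *)
(* position of [w] to the index of its block. Letters of [s] that are not       *)
(* singleton fibres carry the trivial block.                                    *)
Record infl_by (w s : seq nat) (bs : seq (seq nat)) (f : nat -> nat) : Prop := InflBy {
  ib_mono : forall x y, x <= y -> y < size w -> f x <= f y;
  ib_lt : forall x, x < size w -> f x < size s;
  ib_surj : forall p, p < size s -> exists2 x, x < size w & f x = p;
  ib_cmp : forall x y, x < size w -> y < size w -> f x != f y ->
    (nth 0 w x < nth 0 w y) = (nth 0 s (f x) < nth 0 s (f y));
  ib_bs : bs = [seq blk_std w f p | p <- iota 0 (size s)];
  ib_sing : forall p, p < size s -> ~~ sing s p -> size (blk f (size w) p) = 1 }.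

Lemma singPn s p : p < size s ->
  reflect (exists q, [/\ q < size s, q != p & nth 0 s q = nth 0 s p]) (~~ sing s p).
Proof.
move=> ps; apply: (iffP idP) => [/asboolPn|[q [qs qp e]]].
  move=> /existsNP[q /not_implyP[qs /not_implyP[e qp]]].
  by exists q; split=> //; apply/eqP.
by apply/asboolPn => /(_ q qs e)/eqP; rewrite (negPf qp).
Qed.

Lemma ib_size w s bs f : infl_by w s bs f -> size bs = size s.
Proof. by case=> _ _ _ _ -> _; rewrite size_map size_iota. Qed.

Lemma ib_nth w s bs f p : infl_by w s bs f -> p < size s -> nth [::] bs p = blk_std w f p.
Proof.
by case=> _ _ _ _ -> _ ps; rewrite (nth_map 0) ?size_iota // nth_iota.
Qed.

Lemma eq_ib w s bs f f' : (forall x, x < size w -> f x = f' x) ->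
  infl_by w s bs f -> infl_by w s bs f'.
Proof.
move=> E [H1 H2 H3 H4 H5 H6]; split.
- by move=> x y xy yw; rewrite -!E ?H1 //; lia.
- by move=> x xw; rewrite -E ?H2.
- by move=> p /H3[x xw <-]; exists x; rewrite ?E.
- by move=> x y xw yw; rewrite -!E //; apply: H4.
- by rewrite H5; apply: eq_map => p; rewrite /blk_std (eq_blk p E).
- by move=> p ps /(H6 p ps) <-; rewrite (eq_blk p E).
Qed.

Lemma count_blk (P : pred nat) f n N : (forall x, x < n -> f x < N) ->
  count P (iota 0 n) = \sum_(p <- iota 0 N) count P (blk f n p).
Proof.
have -> : (forall x, x < n -> f x < N) <-> {in iota 0 n, forall x, f x < N}.
  by split=> H x; [rewrite mem_iota => /H | move=> xn; apply: H; rewrite mem_iota].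
rewrite /blk; elim: (iota 0 n) => /= [_|x s IH H]; first by rewrite big1.
have xN := H x (mem_head _ _).
rewrite IH; last by move=> y ys; apply: H; rewrite inE ys orbT.
rewrite (bigD1_seq (f x)) ?iota_uniq ?mem_iota //= [RHS](bigD1_seq (f x)) ?iota_uniq ?mem_iota //=.
rewrite eqxx /= addnA; congr (_ + _).
by apply: eq_bigr => p /negPf np; rewrite eq_sym np.
Qed.

Lemma nth_map_iota (T : Type) (F : nat -> T) x0 n p : p < n ->
  nth x0 [seq F p | p <- iota 0 n] p = F p.
Proof. by move=> pn; rewrite (nth_map 0) ?size_iota // nth_iota. Qed.

Lemma ib_sumn w s bs f : infl_by w s bs f -> sumn (shape bs) = size w.
Proof.
move=> R; rewrite (ib_bs R) /shape -map_comp sumnE big_map.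
rewrite -[RHS](size_iota 0) -[RHS]count_predT (count_blk _ (ib_lt R)).
by apply: eq_bigr => p _; rewrite /= size_std size_map count_predT.
Qed.

Lemma eq_blkP f n p x y : x < n -> f x = p -> y < n -> f y = p ->
  size (blk f n p) = 1 -> x = y.
Proof.
move=> xn fx yn fy; have : x \in blk f n p by rewrite mem_blk xn fx eqxx.
have : y \in blk f n p by rewrite mem_blk yn fy eqxx.
by case: blk => [|a [|]] //; rewrite !inE => /eqP-> /eqP->.
Qed.

Lemma blk_gt0 w s bs f p : infl_by w s bs f -> p < size s -> 0 < size (blk f (size w) p).
Proof.
move=> R /(ib_surj R)[x xw fx]; have : x \in blk f (size w) p by rewrite mem_blk xw fx eqxx.
by case: blk.
Qed.

Lemma ib_cmp_in w w' f f' p x y :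
  size w = size w' -> (forall x, x < size w -> f x = f' x) ->
  blk_std w f p = blk_std w' f' p -> x < size w -> y < size w -> f x = p -> f y = p ->
  (nth 0 w x < nth 0 w y) = (nth 0 w' x < nth 0 w' y).
Proof.
move=> ss E; rewrite /blk_std -ss -(eq_blk p E) => /std_map_eq H xw yw fx fy.
by apply: H; rewrite mem_blk ?xw ?yw ?fx ?fy eqxx.
Qed.

(** A monotone surjection onto an initial segment starts at 0 and rises by 0 or 1 at each step; the
    rise is 0 exactly when the two neighbours share a fibre. *)
Lemma surj_mono_eq n N N' (f f' : nat -> nat) :
  (forall x y, x <= y -> y < n -> f x <= f y) ->
  (forall x y, x <= y -> y < n -> f' x <= f' y) ->
  (forall x, x < n -> f x < N) -> (forall x, x < n -> f' x < N') ->
  (forall p, p < N -> exists2 x, x < n & f x = p) ->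
  (forall p, p < N' -> exists2 x, x < n & f' x = p) ->
  (forall x y, x <= y -> y < n -> (f x == f y) = (f' x == f' y)) ->
  forall x, x < n -> f x = f' x.
Proof.
have base g M : (forall x y, x <= y -> y < n -> g x <= g y) ->
    (forall x, x < n -> g x < M) -> (forall p, p < M -> exists2 x, x < n & g x = p) ->
    0 < n -> g 0 = 0.
  move=> m l s n0; have /s[x xn gx] : 0 < M by have := l 0 n0; lia.
  have := m 0 x; lia.
have step g M : (forall x y, x <= y -> y < n -> g x <= g y) ->
    (forall x, x < n -> g x < M) -> (forall p, p < M -> exists2 x, x < n & g x = p) ->
    forall x, x.+1 < n -> g x.+1 = g x + (g x != g x.+1).
  move=> m l s x xn; have := m x x.+1 (leqnSn _) xn.
  case: eqVneq => /= [->|ne] le; first by rewrite addn0.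
  apply/eqP; rewrite eqn_leq; apply/andP; split; last by lia.
  rewrite leqNgt; apply/negP => lt2.
  have /s[y yn gy] : (g x).+1 < M by have := l _ xn; lia.
  have := m y x; have := m x.+1 y; lia.
move=> m m' l l' s s' E; elim=> [|x IH] xn.
  by rewrite (base f N) // (base f' N').
by rewrite (step f N) // (step f' N') // E // IH //; lia.
Qed.

(** The two lists of values are sorted and have the same multiplicities, so they coincide. *)
Lemma eq_mono_blk_size f f' n N N' :
  (forall x y, x <= y -> y < n -> f x <= f y) ->
  (forall x y, x <= y -> y < n -> f' x <= f' y) ->
  (forall x, x < n -> f x < N) -> (forall x, x < n -> f' x < N') ->
  (forall p, size (blk f n p) = size (blk f' n p)) ->
  forall x, x < n -> f x = f' x.
Proof.
move=> m m' l l' E x xn.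
have S g : (forall x y, x <= y -> y < n -> g x <= g y) -> sorted leq (map g (iota 0 n)).
  move=> mg; apply/(sortedP 0) => i; rewrite size_map size_iota => lin.
  by rewrite !(nth_map 0) ?size_iota ?nth_iota //; [apply: mg; lia | lia..].
suff /eq_in_map H : map f (iota 0 n) = map f' (iota 0 n) by apply: H; rewrite mem_iota.
apply: (sorted_eq leq_trans anti_leq); try exact: S.
by apply/allP => p _ /=; rewrite !count_map -!size_filter; apply/eqP/E.
Qed.

(** The block lengths fix the block map; after that, comparisons inside a block are read in [bs] and
    those between blocks in [s]. *)
Lemma ib_inj w w' s bs f f' : cayw w -> cayw w' ->
  infl_by w s bs f -> infl_by w' s bs f' -> w = w'.
Proof.
move=> cw cw' R R'; have ss : size w = size w' by rewrite -(ib_sumn R) (ib_sumn R').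
have B p : p < size s -> blk_std w f p = blk_std w' f' p.
  by move=> ps; rewrite -(ib_nth R ps) (ib_nth R' ps).
have E : forall x, x < size w -> f x = f' x.
  apply: (@eq_mono_blk_size f f' (size w) (size s) (size s)).
  - exact: ib_mono R.
  - by rewrite ss; apply: ib_mono R'.
  - exact: ib_lt R.
  - by rewrite ss; apply: ib_lt R'.
  move=> p; case: (ltnP p (size s)) => [/B /(congr1 size)|ps].
    by rewrite !size_std !size_map -ss.
  have Z g (v : seq nat) : size v = size w ->
      (forall x, x < size v -> g x < size s) -> size (blk g (size w) p) = 0.
    move=> sv H; apply/eqP; rewrite size_eq0; apply/eqP/eqP; rewrite -[_ == _]negbK -has_filter.
    by apply/hasPn => x; rewrite mem_iota -sv => /= /H; lia.
  by rewrite (Z f w) ?(Z f' w') //; [apply: ib_lt R'|apply: ib_lt R].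
apply: cayw_inj => // x y xw yw.
case: (eqVneq (f x) (f y)) => [e|ne].
  by apply: (ib_cmp_in ss E (B (f y) _)) => //; apply: ib_lt R _ _.
by rewrite (ib_cmp R) // (ib_cmp R') -?ss -?E.
Qed.

Lemma ib_det w s bs s' bs' f : cayw s -> cayw s' -> size s = size s' ->
  infl_by w s bs f -> infl_by w s' bs' f -> s = s' /\ bs = bs'.
Proof.
move=> cs cs' ss R R'; split; last by rewrite (ib_bs R) (ib_bs R') ss.
apply: cayw_inj => // p q ps qs.
have [<-|pq] := eqVneq p q; first by rewrite !ltnn.
case: (ib_surj R ps) (ib_surj R qs) => x xw fx [y yw fy]; subst p q.
by rewrite -(ib_cmp R) // (ib_cmp R').
Qed.

Lemma muw_std_map (w : nat -> nat) B : uniq B ->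
  muw (std (map w B)) = count (fun x => `[< forall y, y \in B -> w y = w x -> y = x >]) B.
Proof.
move=> uB; rewrite /muw size_std size_map.
set P := (X in count X B).
rewrite -[B in RHS](mkseq_nth 0) /mkseq count_map; apply: eq_in_count => i.
rewrite mem_iota /= add0n => iB; rewrite /P {P}; apply: asbool_equiv_eq.
have E q : q < size B -> (nth 0 (std (map w B)) q = nth 0 (std (map w B)) i) <->
   (w (nth 0 B q) = w (nth 0 B i)).
  move=> qB; have := @std_lt (map w B) q i; have := @std_lt (map w B) i q.
  by rewrite !size_map qB iB !(nth_map 0 0 w) // => /(_ isT isT) ? /(_ isT isT) ?; lia.
split=> [H y /(nthP 0)[q qB <-] /(E q qB) /H|H q].
  by rewrite size_std size_map => ->.
rewrite size_std size_map => qB /(E q qB) /H; rewrite mem_nth // => /(_ isT) /eqP.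
by rewrite nth_uniq // => /eqP.
Qed.

(** A letter shared by two blocks forces a repeated letter of [s], so over a singleton of [s] being
    a singleton in [w] is the same as being one in the block. Over a repeated letter of [s], every
    letter of [w] is repeated. *)
Lemma ib_muw w s bs f : infl_by w s bs f ->
  muw w = \sum_(p <- iota 0 (size s) | sing s p) muw (nth [::] bs p).
Proof.
move=> R; rewrite /muw (count_blk _ (ib_lt R)) [RHS]big_mkcond.
rewrite big_seq [RHS]big_seq; apply: eq_bigr => p; rewrite mem_iota /= add0n => ps.
rewrite (ib_nth R ps) -/(muw _).
case: ifPn => [sp|nsp].
  rewrite muw_std_map ?blk_uniq //; apply: eq_in_count => x.
  rewrite mem_blk => /andP[xw /eqP fx]; apply: asbool_equiv_eq; split=> H y.
    by rewrite mem_blk => /andP[yw _]; apply: H.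
  move=> yw e; apply: H => //; rewrite mem_blk yw -fx /=; apply: contraT => ne.
  have := ib_cmp R yw xw ne; have := ib_cmp R xw yw.
  rewrite eq_sym ne e ltnn => /(_ isT) c1 c2.
  move/asboolP: sp => /(_ (f y) (ib_lt R yw)); rewrite -fx => h.
  by move/eqP: ne; case; apply: h; lia.
apply/eqP; rewrite -leqn0 leqNgt -has_count; apply/hasPn => x.
rewrite mem_blk => /andP[xw /eqP fx].
have /(singPn ps)[q [qs qp e]] := nsp.
have [y yw fy] := ib_surj R qs.
apply/singPn => //; exists y; split=> //.
  by apply/eqP => yx; move/eqP: qp; apply; rewrite -fy yx.
have := @ib_cmp _ _ _ _ R x y xw yw; have := @ib_cmp _ _ _ _ R y x yw xw.
by rewrite fx fy e ltnn qp eq_sym qp => /(_ isT) ? /(_ isT) ?; lia.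
Qed.

(** * Construction of inflations *)

Lemma std_size1 v : size v = 1 -> std v = [:: 0].
Proof. by case: v => [|x []] // _; rewrite /std /rk /= ltnn. Qed.

(** The word [s] standardises one letter per block, and the hypothesis on comparisons makes the
    choice immaterial. The last hypothesis says that a block of two or more positions shares no
    letter with the outside, so such a block sits on a singleton of [s]. *)
Lemma ib_make w f N :
  (forall x y, x <= y -> y < size w -> f x <= f y) ->
  (forall x, x < size w -> f x < N) ->
  (forall p, p < N -> exists2 x, x < size w & f x = p) ->
  (forall x y x' y', x < size w -> y < size w -> x' < size w -> y' < size w ->
     f x = f x' -> f y = f y' -> f x != f y ->
     (nth 0 w x < nth 0 w y) = (nth 0 w x' < nth 0 w y')) ->
  (forall x x' y, x < size w -> x' < size w -> y < size w ->
     f x = f x' -> x != x' -> f y != f x -> nth 0 w y != nth 0 w x) ->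
  exists s, [/\ cayw s, size s = N
              & infl_by w s [seq blk_std w f p | p <- iota 0 N] f].
Proof.
move=> mono lt surj cmp nons.
pose g p := nth 0 (blk f (size w) p) 0.
have gP p : p < N -> g p < size w /\ f (g p) = p.
  move=> /surj[x xw fx]; have : x \in blk f (size w) p by rewrite mem_blk xw fx eqxx.
  rewrite -index_mem => h; have : g p \in blk f (size w) p by rewrite mem_nth //; lia.
  by rewrite mem_blk => /andP[-> /eqP].
pose s := std [seq nth 0 w (g p) | p <- iota 0 N].
have ss : size s = N by rewrite size_std size_map size_iota.
have sE p q : p < N -> q < N ->
    (nth 0 s p < nth 0 s q) = (nth 0 w (g p) < nth 0 w (g q)).
  by move=> pN qN; rewrite std_lt ?size_map ?size_iota // !nth_map_iota.
exists s; split=> //; first exact: cayw_std.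
split=> //; rewrite ?ss //.
- move=> x y xw yw ne; have [gx fx] := gP _ (lt _ xw); have [gy fy] := gP _ (lt _ yw).
  by rewrite sE ?lt //; apply: cmp; rewrite ?fx ?fy.
- move=> p pN /singPn []; rewrite ?ss // => q [qN qp e].
  have [gpw fgp] := gP _ pN; have [gqw fgq] := gP _ qN.
  have we : nth 0 w (g q) = nth 0 w (g p).
    by have := sE p q pN qN; have := sE q p qN pN; rewrite e ltnn; lia.
  have u := blk_uniq f (size w) p.
  have := mem_blk f (size w) p; move: u.
  have : g p \in blk f (size w) p by rewrite mem_blk gpw fgp eqxx.
  case: blk => [|a [|b l]] // _ /= ab H; exfalso.
  have := H a; have := H b; rewrite !inE !eqxx orbT => /esym/andP[bw /eqP fb].
  move=> /esym/andP[aw /eqP fa].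
  have : exists2 c, c < size w & f c = p /\ c != g p.
    case: (eqVneq a (g p)) => [ea|]; last by exists a.
    exists b => //; split=> //; apply/eqP => eb.
    by move: ab; rewrite !inE ea eb eqxx.
  move=> [c cw [fc cg]]; have := nons (g p) c (g q) gpw cw gqw.
  by rewrite fgp fc eq_sym cg fgq qp we eqxx => /(_ erefl isT isT).
Qed.

Lemma ltn_lex K x y a b : x < y -> a < K -> x * K + a < y * K + b.
Proof.
move=> xy aK; apply: leq_trans (leq_addr b _); apply: leq_trans (_ : x.+1 * K <= _).
  by rewrite mulSn addnC ltn_add2r.
by rewrite leq_mul2r xy orbT.
Qed.

Fixpoint pairs k (bs : seq (seq nat)) : seq (nat * nat) :=
  if bs is b :: bs' then map (pair k) b ++ pairs k.+1 bs' else [::].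

(* The key encodes (letter of [s], letter of the block) lexicographically.      *)
Definition infl (s : seq nat) bs : seq nat :=
  std [seq nth 0 s q.1 * (sumn (flatten bs)).+1 + q.2 | q <- pairs 0 bs].

Definition pidx bs x := (nth (0, 0) (pairs 0 bs) x).1.

Lemma size_pairs k bs : size (pairs k bs) = sumn (shape bs).
Proof. by elim: bs k => //= b bs IH k; rewrite size_cat size_map IH. Qed.

Lemma pairs_ge k bs q : q \in pairs k bs ->
  [/\ k <= q.1, q.1 < k + size bs & q.2 \in flatten bs].
Proof.
elim: bs k => //= b bs IH k; rewrite mem_cat => /orP[/mapP[y yb ->]|/IH[]] /=.
  by rewrite mem_cat yb; split=> //; lia.
by move=> h1 h2 h3; rewrite mem_cat h3 orbT; split=> //; lia.
Qed.

Lemma pairs_mono k bs : pairwise (fun q r => q.1 <= r.1) (pairs k bs).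
Proof.
elim: bs k => //= b bs IH k; rewrite pairwise_cat IH andbT; apply/andP; split.
  apply/allrelP => q r /mapP[y _ ->] /pairs_ge[] /=; lia.
by rewrite pairwise_map; elim: b => //= y b ->; rewrite andbT; apply/allP => z _ /=.
Qed.

Lemma pairs_filter k bs p : k <= p ->
  [seq q <- pairs k bs | q.1 == p] = map (pair p) (nth [::] bs (p - k)).
Proof.
elim: bs k => [|b bs IH] k kp /=; first by rewrite nth_nil.
rewrite filter_cat filter_map /=; case: (eqVneq k p) => [->|kp'].
  rewrite subnn /= (eq_filter (a2 := predT)) ?filter_predT; last by move=> y /=; rewrite eqxx.
  rewrite (_ : [seq _ <- _ | _] = [::]) ?cats0 //.
  by apply/eqP; rewrite -[_ == _]negbK -has_filter; apply/hasPn => q /pairs_ge[] /=; lia.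
rewrite (eq_filter (a2 := pred0)) ?filter_pred0 //=; last by move=> y /=; apply/negbTE.
have kp2 : k < p by lia.
by rewrite (IH _ kp2) -(subnSK kp2).
Qed.

Lemma size_infl s bs : size (infl s bs) = sumn (shape bs).
Proof. by rewrite size_std size_map size_pairs. Qed.

Lemma cayw_infl s bs : cayw (infl s bs).
Proof. exact: cayw_std. Qed.

Lemma leq_sumn (v : seq nat) y : y \in v -> y <= sumn v.
Proof. by elim: v => //= z v IH; rewrite inE => /orP[/eqP->|/IH]; lia. Qed.

(** Different letters of [s] decide the comparison of keys. Equal letters at different positions are
    not singletons, so both their blocks are trivial and the keys tie, as [ib_cmp] demands. *)
Lemma infl_byP s bs : size bs = size s ->
  (forall p, p < size s -> 0 < size (nth [::] bs p)) ->
  (forall p, p < size s -> cayw (nth [::] bs p)) ->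
  (forall p, p < size s -> ~~ sing s p -> nth [::] bs p = [:: 0]) ->
  infl_by (infl s bs) s bs (pidx bs).
Proof.
move=> ss ne cy sg; set w := infl s bs; set P := pairs 0 bs.
set K := (sumn (flatten bs)).+1.
have sw : size w = size P by rewrite size_infl size_pairs.
pose at_ x := nth (0, 0) P x.
have PP x : x < size w -> pidx bs x < size s /\ (at_ x).2 < K.
  rewrite sw => xw; have := mem_nth (0, 0) xw.
  by move=> /pairs_ge[_]; rewrite ss => ? /leq_sumn; split.
have cmpw x y : x < size w -> y < size w -> (nth 0 w x < nth 0 w y) =
   (nth 0 s (pidx bs x) * K + (at_ x).2 < nth 0 s (pidx bs y) * K + (at_ y).2).
  by rewrite sw => xw yw; rewrite /w /infl std_lt ?size_map // !(nth_map (0, 0)).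
have blkE p : map at_ (blk (pidx bs) (size w) p) = map (pair p) (nth [::] bs p).
  have := @pairs_filter 0 bs p (leq0n p); rewrite subn0 => <-.
  rewrite -/P -[P in RHS](mkseq_nth (0, 0)).
  by rewrite /mkseq filter_map -sw.
have sblk p : size (blk (pidx bs) (size w) p) = size (nth [::] bs p).
  by rewrite -(size_map at_) blkE size_map.
split.
- move=> x y; rewrite leq_eqVlt => /orP[/eqP->//|xy] yw.
  have /(pairwiseP (0, 0)) H := pairs_mono 0 bs.
  by apply: H; rewrite ?inE -/P -?sw //; lia.
- by move=> x /PP[].
- move=> p ps; have := ne p ps; rewrite -sblk.
  have := mem_blk (pidx bs) (size w) p; case: blk => // x l /(_ x).
  by rewrite mem_head => /esym/andP[xw /eqP]; exists x.
- move=> x y xw yw; rewrite cmpw //.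
  have [_ +] := PP x xw; have [_ +] := PP y yw.
  case: (ltngtP (nth 0 s (pidx bs x)) (nth 0 s (pidx bs y))) => [h|h|e] bK aK ne'.
  + by rewrite ltn_lex.
  + by apply/negbTE; rewrite -leqNgt ltnW // ltn_lex.
  have [px _] := PP x xw; have [py _] := PP y yw.
  have nx : ~~ sing s (pidx bs x) by apply/singPn => //; exists (pidx bs y); rewrite eq_sym ne' e.
  have ny : ~~ sing s (pidx bs y) by apply/singPn => //; exists (pidx bs x); rewrite ne' e.
  have v0 z : z < size w -> ~~ sing s (pidx bs z) -> (at_ z).2 = 0.
    move=> zw nz; have : at_ z \in map at_ (blk (pidx bs) (size w) (pidx bs z)).
      by rewrite map_f // mem_blk zw eqxx.
    by rewrite blkE sg //; [rewrite inE => /eqP->|have [] := PP z zw].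
  by rewrite !v0 // e !ltnn.
- apply: (@eq_from_nth _ [::]) => [|p]; first by rewrite size_map size_iota.
  rewrite ss => ps; rewrite nth_map_iota // -[LHS](eqP (cy p ps)).
  have -> : nth [::] bs p = map snd (map at_ (blk (pidx bs) (size w) p)).
    by rewrite blkE -map_comp map_id.
  rewrite -map_comp /blk_std; apply/std_map_eq => x y.
  rewrite !mem_blk => /andP[xw /eqP fx] /andP[yw /eqP fy].
  by rewrite cmpw // fx fy ltn_add2l.
by move=> p ps nsg; rewrite sblk sg.
Qed.

(** * H-intervals and simple words *)

(* The H-interval of positions [a, b), half-open: no outside value lies weakly  *)
(* between two inside values.                                                   *)
Definition h_itv (w : seq nat) a b := [/\ a < b, b <= size w &
  forall x, x < size w -> ~~ (a <= x < b) ->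
    (forall y, a <= y < b -> nth 0 w x < nth 0 w y) \/
    (forall y, a <= y < b -> nth 0 w y < nth 0 w x)].

Definition proper_h_itv w a b := h_itv w a b /\ b - a < size w.

Definition simplew w := forall a b, h_itv w a b -> b = a.+1 \/ (a = 0 /\ b = size w).

(* [e = true] is a cut of a direct sum, [e = false] one of a skew sum. *)
Definition cut e (w : seq nat) c := 0 < c < size w /\
  forall x y, x < c -> c <= y < size w ->
    if e then nth 0 w x < nth 0 w y else nth 0 w y < nth 0 w x.

Definition dec e w := `[< exists c, cut e w c >].

Definition indec w := ~~ dec true w && ~~ dec false w.

(** The first and last letters would have to compare both ways. *)
Lemma dec_excl w : dec true w -> ~~ dec false w.
Proof.
move=> /asboolP[c [c1 H]]; apply/asboolPn => -[d [d1 G]].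
have := H 0 (size w).-1; have := G 0 (size w).-1; lia.
Qed.

Lemma indecP w e c : indec w -> ~ cut e w c.
Proof.
by case/andP=> /asboolPn n1 /asboolPn n2 h; case: e h => h; [apply: n1|apply: n2]; exists c.
Qed.

(** * Contraction of maximal proper H-intervals *)

(** An outside letter compares in one way with each interval, and the common position [a'] makes the
    two ways agree. Indecomposability serves to keep the union proper. *)
Lemma phint_union w a b a' b' : indec w -> proper_h_itv w a b -> proper_h_itv w a' b' ->
  a <= a' -> a' < b -> b <= b' -> proper_h_itv w a b'.
Proof.
move=> iw [[ab bw H] pw] [[ab' bw' H'] pw'] aa ba bb.
have U : h_itv w a b'.
  split; rewrite ?(leq_trans ab) // => x xw xn.
  have /(H x xw) c1 : ~~ (a <= x < b) by lia.
  have /(H' x xw) c2 : ~~ (a' <= x < b') by lia.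
  case: c1 => c1; case: c2 => c2; have := c1 a'; have := c2 a' => h1 h2; [left|exfalso; lia|exfalso; lia|right];
  move=> y yin; case: (ltnP y b) => yb; by [apply: c1; lia|apply: c2; lia].
split=> //; rewrite ltnNge; apply/negP => full.
(* If the union were everything, comparison through the letter at [b] would turn [a'] into a cut. *)
have [ea eb] : a = 0 /\ b' = size w by lia.
subst a b'.
have aw : 0 < a' < b by lia.
have bw2 : b < size w by lia.
(* The sign of [w x] against [w y], [x < a' <= y], is that of [w 0] against [w b]. *)
have C1 x : x < a' -> (forall y, a' <= y < size w -> nth 0 w x < nth 0 w y) \/
    (forall y, a' <= y < size w -> nth 0 w y < nth 0 w x).
  by move=> xa; apply: H'; lia.
have C2 : (forall y, 0 <= y < b -> nth 0 w b < nth 0 w y) \/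
    (forall y, 0 <= y < b -> nth 0 w y < nth 0 w b) by apply: H; lia.
case: C2 => C2.
  apply: (@indecP w false a' iw); split; first by lia.
  move=> x y xa /= yin; case: (C1 x xa) => c; last by apply: c.
  by have := c b; have := C2 x; lia.
apply: (@indecP w true a' iw); split; first by lia.
move=> x y xa /= yin; case: (C1 x xa) => c; first by apply: c.
by have := c b; have := C2 x; lia.
Qed.

(* No proper H-interval contains both [c - 1] and [c].                          *)
Definition block_start w c := `[< forall a b, proper_h_itv w a b -> ~ (a < c < b) >].
Definition block_index w x := count (block_start w) (iota 1 x).

Lemma block_indexS w x : block_index w x.+1 = block_index w x + block_start w x.+1.
Proof. by rewrite /block_index -(addn1 x) iotaD count_cat /= addn0 add1n addn1. Qed.

Lemma block_index_mono w x y : x <= y -> block_index w x <= block_index w y.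
Proof.
move=> /subnKC <-; elim: (y - x) => [|k IH]; first by rewrite addn0.
by rewrite addnS block_indexS; lia.
Qed.

Lemma block_index_surj w p n : p <= block_index w n -> exists2 x, x <= n & block_index w x = p.
Proof.
elim: n => [|n IH]; first by exists 0 => //; move: H; rewrite /block_index /=; lia.
case: (leqP p (block_index w n)) => [/IH[x xn <-] _|h]; first by exists x; lia.
by move=> h2; exists n.+1 => //; move: h2; rewrite block_indexS; case: block_start => /=; lia.
Qed.

Lemma block_index_phint w a b x y : proper_h_itv w a b -> a <= x < b -> a <= y < b -> block_index w x = block_index w y.
Proof.
move=> h; wlog xy : x y / x <= y => [W hx hy|].
  by case: (leqP x y) => l; [|symmetry]; apply: W => //; lia.
move: xy => /subnKC <-; elim: (y - x) => [|k IH] hx hy; first by rewrite addn0.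
rewrite addnS block_indexS IH //; last by lia.
have -> : block_start w (x + k).+1 = false; last by rewrite addn0.
by apply/asboolP => /(_ _ _ h); apply; lia.
Qed.

(** Neighbouring positions with equal index lie in a common proper H-interval, and [phint_union]
    chains these intervals from [x] to [y]. *)
Lemma block_index_eq_phint w x y : indec w -> x < y -> block_index w x = block_index w y ->
  exists a b, proper_h_itv w a b /\ a <= x /\ y < b.
Proof.
move=> iw; elim: y => // y IH xy e.
have := block_index_mono w (leqnSn y); have /(block_index_mono w) : x <= y by lia.
rewrite block_indexS in e *; move=> m1 m2.
have nb : ~~ block_start w y.+1 by lia.
have /asboolPn/existsNP[a /existsNP[b /not_implyP[h /contrapT ay]]] := nb.
have e' : block_index w x = block_index w y by lia.
case: (eqVneq x y) => [xy'|xy']; first by exists a, b; split=> //; lia.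
have [|a' [b' [h' [ax yb]]]] := IH _ e'; first by lia.
case: (ltnP y.+1 b') => yb'; first by exists a', b'; split=> //; lia.
case: (leqP a a') => aa; first by exists a, b; split=> //; lia.
exists a', b; split; last by lia.
apply: (phint_union iw h' h); lia.
Qed.

Lemma mono_thr (P : pred nat) n : (forall x y, x <= y -> y < n -> P y -> P x) ->
  exists2 a, a <= n & forall x, x < n -> P x = (x < a).
Proof.
elim: n => [|n IH] H; first by exists 0.
case: (boolP (P n)) => [Pn|nP].
  by exists n.+1 => // x xn; rewrite xn; apply: (H x n).
have [x y xy yn|a an aP] := IH; first by apply: H => //; lia.
exists a; first by lia.
move=> x; rewrite ltnS leq_eqVlt => /orP[/eqP->|/aP//].
by rewrite (negPf nP); apply/esym/negbTE; lia.
Qed.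

(** Since [f] is monotone, preimages of intervals are intervals of positions; these thresholds are
    their endpoints. *)
Lemma ib_thr w s bs f i : infl_by w s bs f ->
  exists2 a, a <= size w & forall x, x < size w -> (f x < i) = (x < a).
Proof.
move=> R; apply: mono_thr => x y xy yw.
by have := ib_mono R xy yw; lia.
Qed.

Lemma block_index_out w x y : indec w -> x < size w -> y < size w -> block_index w x != block_index w y ->
  forall a b, proper_h_itv w a b -> a <= x < b -> ~~ (a <= y < b).
Proof.
move=> iw xw yw ne a b h xin; apply/negP => yin; move/eqP: ne; apply.
exact: (block_index_phint h).
Qed.

(** Distinct positions of one block lie in a proper H-interval that avoids [y], and all of its
    letters are on the same side of the letter at [y]. *)
Lemma block_index_cmp w x x' y : indec w -> x < size w -> x' < size w -> y < size w ->
  block_index w x = block_index w x' -> block_index w y != block_index w x ->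
  [/\ (nth 0 w x < nth 0 w y) = (nth 0 w x' < nth 0 w y),
      (nth 0 w y < nth 0 w x) = (nth 0 w y < nth 0 w x') &
      x != x' -> nth 0 w y != nth 0 w x].
Proof.
move=> iw; wlog xx : x x' / x < x' => [W xw x'w yw e ne|].
  have [l|[l|l]] : x < x' \/ x' < x \/ x = x' by lia.
  - exact: W.
  - have [||||||h1 h2 h3] := W x' x => //; first by rewrite -e.
    split=> // _; have := h3 (_ : x' != x); lia.
  by subst; split=> //; rewrite eqxx.
move=> xw x'w yw e ne; have [a [b [h [ax xb]]]] := block_index_eq_phint iw xx e.
have yn := block_index_out iw xw yw _ h; rewrite eq_sym ne in yn.
have /yn yn' : a <= x < b by lia.
have [[_ _ H] _] := h; case: (H y yw (yn' _)) => // c;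
have := c x; have := c x'; split; lia.
Qed.

Lemma indec_simple w : cayw w -> indec w -> 3 <= size w ->
  exists s bs, [/\ cayw s, simplew s, 3 <= size s & infl_by w s bs (block_index w)].
Proof.
move=> cw iw w3.
have lt x : x < size w -> block_index w x < (block_index w (size w).-1).+1.
  by move=> xw; rewrite ltnS; apply: block_index_mono; lia.
have [||||| s [cs ss R]] := @ib_make w (block_index w) (block_index w (size w).-1).+1.
- by move=> x y xy _; apply: block_index_mono.
- exact: lt.
- by move=> p; rewrite ltnS => /block_index_surj[x xn <-]; exists x => //; lia.
- move=> x y x' y' xw yw x'w y'w ex ey ne.
  have ne' : block_index w y != block_index w x by rewrite eq_sym.
  have ne2 : block_index w x' != block_index w y by rewrite -ex.
  have [-> _ _] := block_index_cmp iw xw x'w yw ex ne'.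
  by have [_ -> _] := block_index_cmp iw yw y'w x'w ey ne2.
- move=> x x' y xw x'w yw ex xx ne.
  by have [_ _] := block_index_cmp iw xw x'w yw ex ne; apply.
exists s, [seq blk_std w (block_index w) p | p <- iota 0 (block_index w (size w).-1).+1].
split=> //.
- move=> i j [ij js H].
  case: (eqVneq j i.+1) => [|ji]; first by left.
  case: (boolP ((i == 0) && (j == size s))) => [/andP[/eqP ? /eqP ?]|nfull]; first by right.
  (* The preimage [[a, b)] of a nontrivial H-interval of [s] would be a proper H-interval of [w]
     that meets the two blocks [i] and [i.+1]. *)
  exfalso; have [a aw aP] := ib_thr i R; have [b bw bP] := ib_thr j R.
  have [|x xw fx] := ib_surj R (_ : i < size s); first by lia.
  have [|y yw fy] := ib_surj R (_ : i.+1 < size s); first by lia.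
  have xin : a <= x < b.
    by have := aP x xw; have := bP x xw; rewrite fx; lia.
  have yin : a <= y < b.
    by have := aP y yw; have := bP y yw; rewrite fy; lia.
  suff h : proper_h_itv w a b by have := block_index_phint h xin yin; rewrite fx fy; lia.
  split.
    split=> // [|z zw zn]; first by lia.
    have fz : ~~ (i <= block_index w z < j).
      by have := aP z zw; have := bP z zw; lia.
    have IN q : a <= q < b -> q < size w /\ i <= block_index w q < j.
      by move=> qin; have qw : q < size w by [lia]; have := aP q qw; have := bP q qw; lia.
    have [c|c] := H _ (ib_lt R zw) fz; [left|right] => q /IN[qw qin];
    rewrite (ib_cmp R) ?c //; apply/eqP => e; lia.
  rewrite ltnNge; apply/negP => full.
  have [a0 bn] : a = 0 /\ b = size w by lia.
  have [|z zw fz] := ib_surj R (_ : 0 < size s); first by lia.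
  have [|z' zw' fz'] := ib_surj R (_ : (size s).-1 < size s); first by lia.
  have := aP z zw; have := bP z' zw'; lia.
- have s1 : size s != 1.
    apply/eqP => s1; have f0 := ib_lt R (_ : 0 < size w).
    have f1 := ib_lt R (_ : (size w).-1 < size w).
    have [|||a [b [[[ab bw H] pw] h]]] := @block_index_eq_phint w 0 (size w).-1; lia.
  have s2 : size s != 2.
    apply/eqP => s2; have [a aw aP] := ib_thr 1 R.
    have [|z0 zw0 fz0] := ib_surj R (_ : 0 < size s); first by lia.
    have [|z1 zw1 fz1] := ib_surj R (_ : 1 < size s); first by lia.
    have a1 : 0 < a < size w by have := aP _ zw0; have := aP _ zw1; lia.
    have B x : x < size w -> block_index w x = (a <= x).
      by move=> xw; have := aP x xw; have := ib_lt R xw; lia.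
    have C x y : x < a -> a <= y < size w ->
       (nth 0 w x < nth 0 w y) = (nth 0 s 0 < nth 0 s 1) /\
       (nth 0 w y < nth 0 w x) = (nth 0 s 1 < nth 0 s 0).
      move=> xa yin; have fx : block_index w x = 0 by rewrite B; lia.
      have fy : block_index w y = 1 by rewrite B; lia.
      by split; rewrite (ib_cmp R) ?fx ?fy //; lia.
    (* Unequal letters of [s] expose a cut of [w] at [a]. If they are equal, one of the two blocks
       has at least two positions, as [w] has length at least three, and it shares a letter with the
       other block. *)
    case: (ltngtP (nth 0 s 0) (nth 0 s 1)) => [l|l|e].
    - apply: (@indecP w true a iw); split=> // x y xa yin /=.
      by have [-> _] := C x y xa yin.
    - apply: (@indecP w false a iw); split=> // x y xa yin /=.
      by have [_ ->] := C x y xa yin.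
    case: (ltnP 1 a) => a2.
      have [|||||_ _] := @block_index_cmp w 0 1 a iw; rewrite ?B; try lia.
      by have := C 0 a; rewrite e ltnn; lia.
    have [|||||_ _] := @block_index_cmp w a a.+1 0 iw; rewrite ?B; try lia.
    by have := C 0 a; rewrite e ltnn; lia.
  by rewrite ss in s1 s2 *; lia.
Qed.

(** * Inflations of a simple word of length at least three *)

Section Simple.
Variables (w s : seq nat) (bs : seq (seq nat)) (f : nat -> nat).
Hypotheses (R : infl_by w s bs f) (sim : simplew s) (s3 : 3 <= size s).

(** The blocks met by a proper H-interval form an H-interval of [s]. By simplicity this is a single
    letter, as wanted, or all of [s], which is then excluded. *)
Lemma simple_phint a b x y : proper_h_itv w a b -> a <= x < b -> a <= y < b -> f x = f y.
Proof.
move=> [[ab bw H] pw].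
have mono u v : u <= v -> v < size w -> f u <= f v := @ib_mono _ _ _ _ R u v.
wlog xy : x y / x <= y => [W hx hy|hx hy].
  by case: (leqP x y) => l; [|symmetry]; apply: W => //; lia.
apply/eqP; apply: contraT => ne.
have lxy : f x < f y by have := mono x y; lia.
have l1 : f a <= f x by apply: mono; lia.
have l2 : f y <= f b.-1 by apply: mono; lia.
have sb : f b.-1 < size s by apply: ib_lt R _ _; lia.
have att q : f a <= q <= f b.-1 -> exists2 z, a <= z < b & f z = q.
  move=> qin; have [|z zw fz] := ib_surj R (_ : q < size s); first by lia.
  case: (ltnP z a) => za.
    by exists a; [lia|have := mono z a; lia].
  case: (ltnP z b) => zb; first by exists z; lia.
  by exists b.-1; [lia|have := mono b.-1 z; lia].
(* An outside position [z] passes its comparisons on to [s], as long as its own block is kept out of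
   the target interval. *)
have tr z i j : z < size w -> ~~ (a <= z < b) -> ~~ (i <= f z < j) -> f a <= i -> j <= (f b.-1).+1 ->
    (forall q, i <= q < j -> nth 0 s (f z) < nth 0 s q) \/
    (forall q, i <= q < j -> nth 0 s q < nth 0 s (f z)).
  move=> zw zn fz ai bj; have [c|c] := H z zw zn; [left|right] => q qin;
  have [|v vin fv] := att q; try lia;
  rewrite -fv -(ib_cmp R) ?c //; try lia; apply/eqP => e; lia.
have h : h_itv s (f a) (f b.-1).+1.
  split; [by lia|by []|move=> p ps pn].
  have [z zw fz] := ib_surj R ps; rewrite -fz; apply: tr => //; last by rewrite fz.
  apply/negP => zin; have := mono a z; have := mono z b.-1; lia.
have [e|[i0 j0]] := sim h; first by lia.
(* All blocks are met, yet the last position (if [a] is 0) or the first one is outside [[a, b)]. It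
   separates its end letter of [s] from all the others, which then form an H-interval of length
   [size s - 1], at least two, against simplicity. *)
case: (posnP a) => a0.
  have bn : b < size w by lia.
  have fn : f (size w).-1 = (size s).-1.
    have := mono b.-1 (size w).-1; have := @ib_lt _ _ _ _ R (size w).-1; lia.
  have : h_itv s 0 (size s).-1.
    split; [lia|lia|move=> p ps pn].
    have -> : p = f (size w).-1 by lia.
    by apply: tr; rewrite ?fn; lia.
  by case/sim; lia.
have f0 : f 0 = 0 by have := mono 0 a; lia.
have : h_itv s 1 (size s).
  split; [lia|lia|move=> p ps pn].
  have -> : p = f 0 by lia.
  by apply: tr; rewrite ?f0; lia.
by case/sim; lia.
Qed.

Lemma hint_proper a b : h_itv w a b -> ~~ ((a == 0) && (b == size w)) -> proper_h_itv w a b.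
Proof. by move=> h n; split=> //; case: h; lia. Qed.

Lemma cut_hint e c : cut e w c -> proper_h_itv w 0 c /\ proper_h_itv w c (size w).
Proof.
move=> [cw H]; split; apply: hint_proper; try lia; split; try lia.
  move=> x xw xn; have xc : c <= x < size w by lia.
  by case: e H => H; [right|left] => y yc; apply: H.
move=> x xw xn; have xc : x < c by lia.
by case: e H => H; [left|right] => y yc; apply: H.
Qed.

(** Both sides of a cut are proper H-intervals, so each lies in one block, and two blocks are too
    few. *)
Lemma simple_indec : indec w.
Proof.
suff N e : ~~ dec e w by rewrite /indec !N.
apply/asboolPn => -[c cc]; have [cw _] := cc; have [h1 h2] := cut_hint cc.
have [|x xw fx] := ib_surj R (_ : 0 < size s); first by lia.
have [|y yw fy] := ib_surj R (_ : 1 < size s); first by lia.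
have [|z zw fz] := ib_surj R (_ : 2 < size s); first by lia.
have A u v : u < c -> v < c -> f u = f v by move=> ? ?; apply: (simple_phint h1); lia.
have B u v : u < size w -> v < size w -> c <= u -> c <= v -> f u = f v.
  by move=> ? ? ? ?; apply: (simple_phint h2); lia.
have := A x y; have := A y z; have := A x z.
have := B x y xw yw; have := B y z yw zw; have := B x z xw zw; lia.
Qed.

(** A block with two positions sits on a singleton of [s], and is itself the required H-interval. *)
Lemma simple_block x y : x < y -> y < size w -> f x = f y ->
  exists a b, [/\ proper_h_itv w a b, a <= x & y < b].
Proof.
move=> xy yw fxy; set p := f y.
have ps : p < size s := ib_lt R yw.
have sp : sing s p.
  apply: contraT => /(ib_sing R ps) H.
  have := @eq_blkP f (size w) p x y; rewrite fxy H yw; lia.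
have [a aw aP] := ib_thr p R; have [b bw bP] := ib_thr p.+1 R.
have xw : x < size w by lia.
exists a, b; have := aP x xw; have := bP y yw; rewrite fxy -/p => h1 h2.
split; try lia; have ab : a < b by lia.
have FP q : q < size w -> (a <= q < b) = (f q == p).
  by move=> qw; have := aP q qw; have := bP q qw; lia.
apply: hint_proper.
  split=> // z zw; rewrite (FP z zw) => ne.
  have := ib_lt R zw => zs.
  have ns : nth 0 s (f z) != nth 0 s p.
    by apply/eqP => e; move/asboolP: sp => /(_ _ zs e)/eqP; rewrite (negPf ne).
  have IN q : a <= q < b -> q < size w /\ f q = p.
    by move=> qin; have qw : q < size w by [lia]; move: qin; rewrite (FP q qw) => /eqP.
  case: (ltngtP (nth 0 s (f z)) (nth 0 s p)) ns => // l _; [left|right] => q /IN[qw fq];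
  by rewrite (ib_cmp R) ?fq // eq_sym.
apply/negP => /andP[/eqP a0 /eqP bn].
have [|u uw fu] := ib_surj R (_ : 0 < size s); first by lia.
have [|v vw fv] := ib_surj R (_ : 1 < size s); first by lia.
have := FP u uw; have := FP v vw; lia.
Qed.
End Simple.

Lemma simple_uniq w s bs f s' bs' f' :
  infl_by w s bs f -> simplew s -> 3 <= size s ->
  infl_by w s' bs' f' -> simplew s' -> 3 <= size s' ->
  forall x, x < size w -> f x = f' x.
Proof.
move=> R sim s3 R' sim' s3'.
apply: (@surj_mono_eq (size w) (size s) (size s')).
- exact: ib_mono R.
- exact: ib_mono R'.
- exact: ib_lt R.
- exact: ib_lt R'.
- exact: ib_surj R.
- exact: ib_surj R'.
move=> x y; rewrite leq_eqVlt => /orP[/eqP->|xy] yw; first by rewrite !eqxx.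
apply/eqP/eqP => e.
  have [a [b [h ax yb]]] := simple_block R s3 xy yw e.
  by apply: (simple_phint R' sim' s3' h); lia.
have [a [b [h ax yb]]] := simple_block R' s3' xy yw e.
by apply: (simple_phint R sim s3 h); lia.
Qed.

(** * Direct and skew sums *)

Definition two e : seq nat := if e then [:: 0; 1] else [:: 1; 0].

Lemma cayw_two e : cayw (two e). Proof. by case: e. Qed.
Lemma size_two e : size (two e) = 2. Proof. by case: e. Qed.
Lemma sing_two e p : p < 2 -> sing (two e) p.
Proof.
move=> p2; apply: contraT => /singPn; rewrite size_two => /(_ p2) [q [q2 qp]].
by case: e p p2 q q2 qp => [] [|[]] // _ [|[]].
Qed.

Lemma two_thr e w bs f : infl_by w (two e) bs f ->
  exists c, cut e w c /\ forall x, x < size w -> f x = (c <= x).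
Proof.
move=> R; have [c cw cP] := ib_thr 1 R.
have [|x xw fx] := ib_surj R (_ : 0 < size (two e)); first by rewrite size_two.
have [|y yw fy] := ib_surj R (_ : 1 < size (two e)); first by rewrite size_two.
have B z : z < size w -> f z = (c <= z).
  by move=> zw; have := cP z zw; have := ib_lt R zw; rewrite size_two; lia.
exists c; split=> //; split; first by have := cP x xw; have := cP y yw; lia.
move=> a b ac bc; have aw : a < size w by lia.
have fa : f a = 0 by rewrite B //; lia.
have fb : f b = 1 by rewrite B; lia.
by case: e R => R; rewrite (ib_cmp R) ?fa ?fb //; lia.
Qed.

Lemma two_dec e w bs f : infl_by w (two e) bs f -> dec e w.
Proof. by move=> /two_thr[c [cc _]]; apply/asboolP; exists c. Qed.

Lemma blk_thr (f : nat -> nat) n c : c <= n -> (forall x, x < n -> f x = (c <= x)) -> blk f n 0 = iota 0 c.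
Proof.
move=> cn fE; rewrite -(@filter_iota_ltn 0 n c) // /blk.
by apply: eq_in_filter => x; rewrite mem_iota /= add0n => /fE->; lia.
Qed.

Lemma blk_std_thr (f : nat -> nat) w c : c <= size w -> (forall x, x < size w -> f x = (c <= x)) ->
  size (blk_std w f 0) = c /\
  forall x y, x < c -> y < c ->
    (nth 0 (blk_std w f 0) x < nth 0 (blk_std w f 0) y) = (nth 0 w x < nth 0 w y).
Proof.
move=> cn fE; rewrite /blk_std (blk_thr cn fE); split.
  by rewrite size_std size_map size_iota.
by move=> x y xc yc; rewrite std_lt ?size_map ?size_iota // !nth_map_iota.
Qed.

(** Together with [restrict_cut]: the cuts of the first summand are the cuts of [w] to the left of
    [c]. *)
Lemma cut_restrict e w (f : nat -> nat) c d : c <= size w -> (forall x, x < size w -> f x = (c <= x)) ->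
  cut e w c -> cut e (blk_std w f 0) d -> cut e w d.
Proof.
move=> cn fE [c0 cH] [d0 dH]; have [su uE] := blk_std_thr cn fE.
rewrite su in d0 dH; split; first by lia.
move=> x y xd yd; case: (ltnP y c) => yc; last by apply: cH; lia.
have := dH x y xd; case: e {cH dH} => H; rewrite -uE; try lia; apply: H; lia.
Qed.

Lemma restrict_cut e w (f : nat -> nat) c d : c <= size w -> (forall x, x < size w -> f x = (c <= x)) ->
  0 < d < c -> cut e w d -> cut e (blk_std w f 0) d.
Proof.
move=> cn fE dc [d0 dH]; have [su uE] := blk_std_thr cn fE.
split; rewrite ?su //; move=> x y xd yd; have := dH x y xd.
by case: e {dH} => H; rewrite uE; try lia; apply: H; lia.
Qed.

(** Splitting at the least cut leaves a first summand that is not a sum of the same sign. *)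
Lemma dec_two e w : dec e w ->
  exists bs f, infl_by w (two e) bs f /\ ~~ dec e (nth [::] bs 0).
Proof.
move=> /asboolP[c0 hc0]; pose P c := `[< cut e w c >].
have exP : exists c, P c by exists c0; apply/asboolP.
case: (ex_minnP exP) => c /asboolP cc min {c0 hc0 exP}.
have [cw cH] := cc.
pose f x : nat := c <= x.
have := @ib_make w f 2; case.
- by move=> x y; rewrite /f; lia.
- by move=> x _; rewrite /f; case: (c <= x).
- by case=> [|[]] // _; [exists 0 | exists c]; rewrite /f; lia.
- move=> x y x' y' xw yw x'w y'w; rewrite /f => ex ey ne.
  case: (leqP c x) => cx.
    have := cH y x; have := cH y' x'; case: e {cH cc P min} => ? ?; lia.
  have := cH x y; have := cH x' y'; case: e {cH cc P min} => ? ?; lia.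
- move=> x x' y xw x'w yw; rewrite /f => ex ne1 ne2.
  have := cH x y; have := cH y x; case: e {cH cc P min} => ? ?; lia.
move=> s [cs ss R].
have es : s = two e.
  apply: cayw_inj => //; rewrite ?cayw_two ?ss ?size_two // => p q p2 q2.
  have f0 : f 0 = 0 by rewrite /f; lia.
  have fc : f c = 1 by rewrite /f leqnn.
  have c1 : (nth 0 w 0 < nth 0 w c) = e by have := cH 0 c; case: (e) => ?; lia.
  have c2 : (nth 0 w c < nth 0 w 0) = ~~ e by have := cH 0 c; case: (e) => ?; lia.
  have := @ib_cmp _ _ _ _ R 0 c; have := @ib_cmp _ _ _ _ R c 0.
  rewrite f0 fc c1 c2 => A B; have {}A : ~~ e = (nth 0 s 1 < nth 0 s 0) by apply: A; lia.
  have {}B : e = (nth 0 s 0 < nth 0 s 1) by apply: B; lia.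
  case: p p2 => [|[]] // _; case: q q2 => [|[]] // _; rewrite ?ltnn // -?A -?B; by case: (e).
subst s; exists [seq blk_std w f p | p <- iota 0 2], f; split=> //=.
apply/asboolPn => -[d cd]; have [d0 _] := cd.
have [su _] := @blk_std_thr f w c (ltnW (proj2 (andP cw))) (fun _ _ => erefl).
have := cut_restrict (ltnW (proj2 (andP cw))) (fun _ _ => erefl) cc cd.
by move=> /asboolP /min; rewrite su in d0; lia.
Qed.

(** Of two different cuts, the smaller one would cut the first summand of the larger one. *)
Lemma two_uniq e w bs bs' f f' : infl_by w (two e) bs f -> infl_by w (two e) bs' f' ->
  ~~ dec e (nth [::] bs 0) -> ~~ dec e (nth [::] bs' 0) ->
  forall x, x < size w -> f x = f' x.
Proof.
move=> R R'; rewrite (ib_nth R) ?(ib_nth R') ?size_two // => n n'.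
have [c [cc fE]] := two_thr R; have [c' [cc' fE']] := two_thr R'.
have [cw _] := cc; have [cw' _] := cc'.
suff E : c = c' by move=> x xw; rewrite fE // fE' // E.
apply/eqP; apply: contraT => ne; have [l|l] : c < c' \/ c' < c by lia.
  move/asboolPn: n'; case; exists c.
  by apply: (restrict_cut _ fE') => //; lia.
move/asboolPn: n; case; exists c'.
by apply: (restrict_cut _ fE) => //; lia.
Qed.

(** * Weighted classes of words and products of their series *)

Local Open Scope ring_scope.

Definition class := (pred (seq nat) * (seq nat -> {poly int}))%type.
Definition class_gf (c : class) : {fps {poly int}} :=
  Fps (fun n => \sum_(w <- cays n | c.1 w) c.2 w).

Definition words_le (c : class) n := [seq w <- flatten [seq cays i | i <- iota 0 n.+1] | c.1 w].

Lemma mem_words_le c n w : (w \in words_le c n) = [&& c.1 w, cayw w & (size w <= n)%N].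
Proof.
rewrite mem_filter; congr (_ && _); apply/flattenP/andP => [[l /mapP[i]]|[cw wn]].
  by rewrite mem_iota add0n ltnS => hi ->; rewrite mem_cays => /andP[/eqP -> ->].
exists (cays (size w)); last by rewrite mem_cays eqxx.
by apply/mapP; exists (size w) => //; rewrite mem_iota.
Qed.

Lemma words_le_uniq c n : uniq (words_le c n).
Proof.
rewrite filter_uniq //; elim: n.+1 => // m IH.
rewrite -addn1 iotaD map_cat flatten_cat /= cats0 cat_uniq IH cays_uniq andbT /=.
apply/hasPn => w; rewrite mem_cays => /andP[/eqP sw _].
apply/flattenP => -[l /mapP[i]]; rewrite mem_iota => /= im ->.
by rewrite mem_cays => /andP[/eqP e _]; move: im; rewrite -e sw add0n ltnn.
Qed.

Fixpoint fillings (cs : seq class) (n : nat) : seq (seq (seq nat)) :=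
  if cs is c :: cs' then
    [seq w :: bs | w <- words_le c n, bs <- fillings cs' (n - size w)%N]
  else if n == 0%N then [:: [::]] else [::].

Definition class_wt (cs : seq class) (bs : seq (seq nat)) : {poly int} :=
  \prod_(cb <- zip cs bs) cb.1.2 cb.2.

Lemma mem_fillings cs n bs : (bs \in fillings cs n) =
  (sumn (shape bs) == n) && all2 (fun (c : class) b => c.1 b && cayw b) cs bs.
Proof.
elim: cs n bs => [|c cs IH] n [|b bs] /=.
- by rewrite eq_sym; case: eqP.
- by rewrite andbF; case: eqP.
- by rewrite andbF; apply/negbTE/negP => /allpairsPdep[x [y [_ _]]].
apply/allpairsPdep/idP => [[x [y [xi]]]|].
  rewrite IH => /andP[/eqP sy ay] [-> ->].
  by move: xi; rewrite mem_words_le => /and3P[-> -> h]; rewrite ay -/(shape y) sy subnKC ?eqxx.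
move=> /andP[/eqP sn /andP[/andP[cb cy] ab]]; exists b, bs; split=> //.
  by rewrite mem_words_le cb cy -sn leq_addr.
by rewrite IH ab andbT -sn addKn.
Qed.

Lemma fillings_uniq cs n : uniq (fillings cs n).
Proof.
elim: cs n => [|c cs IH] n /=; first by case: eqP.
apply: allpairs_uniq_dep => [|w _|]; [exact: words_le_uniq | exact: IH |].
by move=> [w bs] [w' bs'] _ _ /= [-> ->].
Qed.

(** The Cauchy product splits a tuple into its first word, of length [i], and the rest, of total
    length [n - i]. *)
Lemma class_gf_prod cs n :
  (\prod_(c <- cs) class_gf c) n = \sum_(bs <- fillings cs n) class_wt cs bs.
Proof.
elim: cs n => [|c cs IH] n.
  rewrite big_nil coef_fps1 /=; case: eqP => _; last by rewrite big_nil.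
  by rewrite big_seq1 /class_wt /= big_nil.
rewrite big_cons coef_fpsM /= big_allpairs_dep /words_le big_filter big_flatten big_map.
rewrite -(big_mkord xpredT (fun i => class_gf c i * (\prod_(j <- cs) class_gf j) (n - i)%N)).
rewrite /index_iota subn0; apply: eq_bigr => i _.
rewrite /= mulr_suml big_seq_cond [RHS]big_seq_cond; apply: eq_bigr => w.
rewrite mem_cays => /andP[/andP[/eqP <- _] _]; rewrite IH mulr_sumr.
by apply: eq_bigr => bs _; rewrite /class_wt /= big_cons.
Qed.

(** * Series of restricted inflations *)

Definition mu_wt (w : seq nat) : {poly int} := 'X^(muw w).
Definition Cne : class := (fun w => (0 < size w)%N, mu_wt).
Definition Cind e : class := (fun w => (0 < size w)%N && ~~ dec e w, mu_wt).
Definition Cdec e : class := (fun w => dec e w, mu_wt).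
(** The weight is 1 and not t, because the position filled by this block carries a repeated letter
    of the inflated word. *)
Definition Cpt : class := (fun w => w == [:: 0%N], fun=> 1).
Definition Csim : class := (fun w => `[< simplew w >] && (3 <= size w)%N, fun=> 1).
Definition cls s : seq class :=
  [seq if sing s p then Cne else Cpt | p <- iota 0 (size s)].

Lemma dec_size e w : dec e w -> (1 < size w)%N.
Proof. by case/asboolP=> c [h _]; lia. Qed.

Lemma fillingsP cs n bs : reflect
  [/\ size bs = size cs, sumn (shape bs) = n &
    forall p, (p < size cs)%N -> (nth Cpt cs p).1 (nth [::] bs p) /\ cayw (nth [::] bs p)]
  (bs \in fillings cs n).
Proof.
rewrite mem_fillings all2E; apply: (iffP and3P) => [[/eqP sn /eqP sb /allP H]|[sb sn H]].
  split=> // p ps; have pz : (p < size (zip cs bs))%N by rewrite size_zip -sb minnn.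
  by have := H _ (mem_nth (Cpt, [::]) pz); rewrite nth_zip //= => /andP.
split; [exact/eqP | by rewrite sb | apply/(all_nthP (Cpt, [::])) => p].
rewrite size_zip sb minnn => ps; rewrite nth_zip //=; exact/andP/H.
Qed.

Lemma ib_size_eq w s bs s' bs' f f' : infl_by w s bs f -> infl_by w s' bs' f' ->
  (forall x, (x < size w)%N -> f x = f' x) -> size s = size s'.
Proof.
move=> R R' E; apply/eqP; apply: contraT => ne.
have [l|l] : (size s < size s')%N \/ (size s' < size s)%N by lia.
  by have [x xw] := ib_surj R' l; have := ib_lt R xw; rewrite E // => + e; rewrite e; lia.
by have [x xw] := ib_surj R l; have := ib_lt R' xw; rewrite -E // => + e; rewrite e; lia.
Qed.

Lemma ib_size_le w s bs f : infl_by w s bs f -> (size s <= size w)%N.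
Proof.
move=> R; rewrite -[size s](size_iota 0) -[X in (_ <= X)%N](size_iota 0) -(size_map f (iota 0 (size w))).
apply: uniq_leq_size; [exact: iota_uniq|move=> p]; rewrite mem_iota /= add0n => /(ib_surj R)[x xw <-].
by rewrite map_f // mem_iota.
Qed.

Lemma ib_filling w s bs f p : infl_by w s bs f -> (p < size s)%N ->
  cayw (nth [::] bs p) /\ (0 < size (nth [::] bs p))%N.
Proof.
move=> R ps; rewrite (ib_nth R) //; split; first exact: cayw_std.
by rewrite size_std size_map (blk_gt0 R).
Qed.

Lemma fillings_two e n bs : bs \in fillings [:: Cind e; Cne] n ->
  infl_by (infl (two e) bs) (two e) bs (pidx bs).
Proof.
move=> /fillingsP[sb sn H]; apply: infl_byP; rewrite ?size_two // => p p2.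
- by have [] := H p p2; case: p p2 => [|[]] //= _ /andP[].
- by have [] := H p p2.
by rewrite sing_two.
Qed.

(** The bijection behind P = (B - P) B: injective by [two_uniq], surjective by [dec_two]. *)
Lemma two_perm e n : perm_eq [seq infl (two e) bs | bs <- fillings [:: Cind e; Cne] n]
  [seq w <- cays n | dec e w].
Proof.
apply: uniq_perm; rewrite ?filter_uniq ?cays_uniq //.
  rewrite map_inj_in_uniq ?fillings_uniq // => bs bs' h h' E.
  have R := fillings_two h; have R' := fillings_two h'; rewrite -E in R'.
  have N b : b \in fillings [:: Cind e; Cne] n -> ~~ dec e (nth [::] b 0).
    by case/fillingsP => _ _ /(_ 0%N isT) [/andP[]].
  have F := two_uniq R R' (N _ h) (N _ h').
  by have [] := ib_det (cayw_two e) (cayw_two e) erefl (eq_ib F R) R'.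
move=> w; rewrite mem_filter mem_cays; apply/mapP/and3P => [[bs h ->]|[dw /eqP sw cw]].
  have R := fillings_two h; split; [exact: two_dec R| |exact: cayw_infl].
  by rewrite size_infl; case/fillingsP: h => _ -> _.
have [bs [f [R nd]]] := dec_two dw.
have h : bs \in fillings [:: Cind e; Cne] n.
  apply/fillingsP; rewrite (ib_size R) (ib_sumn R) size_two; split=> // p p2.
  have [cp np] : cayw (nth [::] bs p) /\ (0 < size (nth [::] bs p))%N.
    by apply: ib_filling R _; rewrite size_two.
  by split=> //; case: p p2 cp np => [|[]] //= _ _ ->.
exists bs => //; exact: ib_inj cw (cayw_infl _ _) R (fillings_two h).
Qed.

Lemma fillings_cls s n bs : bs \in fillings (cls s) n ->
  infl_by (infl s bs) s bs (pidx bs).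
Proof.
move=> /fillingsP[sb sn H]; rewrite size_map size_iota in sb H.
have {}H p (ps : (p < size s)%N) := H p ps.
have E p : (p < size s)%N -> nth Cpt (cls s) p = if sing s p then Cne else Cpt.
  by move=> ps; rewrite nth_map_iota.
apply: infl_byP => // p ps; have [] := H p ps; rewrite E //; case: (sing s p) => //= /eqP-> //.
Qed.

Lemma mem_fillings_cls w s bs f : infl_by w s bs f -> bs \in fillings (cls s) (size w).
Proof.
move=> R; apply/fillingsP; rewrite (ib_size R) (ib_sumn R) size_map size_iota; split=> // p ps.
have [cp np] := ib_filling R ps; split=> //; rewrite nth_map_iota //.
by case: ifPn => //= /(ib_sing R ps) s1; rewrite (ib_nth R ps) /blk_std std_size1 ?size_map.
Qed.

(** The bijection behind S(x, B): injective by [simple_uniq], surjective by [indec_simple]. *)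
Lemma sim_perm n : perm_eq [seq infl s bs | s <- words_le Csim n, bs <- fillings (cls s) n]
  [seq w <- cays n | indec w && (3 <= size w)%N].
Proof.
apply: uniq_perm; rewrite ?filter_uniq ?cays_uniq //.
  apply: allpairs_uniq_dep => [|s _|]; [exact: words_le_uniq|exact: fillings_uniq|].
  move=> [s bs] [s' bs'] /allpairsPdep[x [y [+ + [ex ey]]]]; rewrite -{}ex -{}ey {x y}.
  rewrite mem_words_le => /and3P[/andP[/asboolP sim s3] cs _] h.
  move=> /allpairsPdep[x [y [+ + [ex ey]]]]; rewrite -{}ex -{}ey {x y}.
  rewrite mem_words_le => /and3P[/andP[/asboolP sim' s3'] cs' _] h' /= E.
  have R := fillings_cls h; have R' := fillings_cls h'; rewrite -E in R'.
  have F := simple_uniq R sim s3 R' sim' s3'.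
  by have [-> ->] := ib_det cs cs' (ib_size_eq R R' F) (eq_ib F R) R'.
move=> w; rewrite mem_filter mem_cays; apply/allpairsPdep/andP.
  move=> [s [bs [+ h ->]]]; rewrite mem_words_le => /and3P[/andP[/asboolP sim s3] cs _].
  have R := fillings_cls h; rewrite cayw_infl andbT; split.
    by rewrite (simple_indec R sim s3) (leq_trans s3 (ib_size_le R)).
  by rewrite size_infl; case/fillingsP: h => _ -> _.
move=> [/andP[iw w3] /andP[/eqP sw cw]].
have [s [bs [cs sim s3 R]]] := indec_simple cw iw w3.
have h := mem_fillings_cls R; exists s, bs; rewrite -sw; split=> //.
  by rewrite mem_words_le /= s3 cs (ib_size_le R) andbT; apply/andP; split=> //; apply/asboolP.
exact: ib_inj cw (cayw_infl _ _) R (fillings_cls h).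
Qed.

Lemma class_wt_nth cs bs : size bs = size cs ->
  class_wt cs bs = \prod_(p <- iota 0 (size cs)) (nth Cpt cs p).2 (nth [::] bs p).
Proof.
move=> sb; rewrite /class_wt (big_nth (Cpt, [::])) size_zip sb minnn /index_iota subn0.
by apply: eq_bigr => p _; rewrite nth_zip.
Qed.

Lemma ib_wt w s bs f cs : infl_by w s bs f -> size cs = size s ->
  (forall p, (p < size s)%N -> (nth Cpt cs p).2 = if sing s p then mu_wt else fun=> 1) ->
  class_wt cs bs = mu_wt w.
Proof.
move=> R sc H; rewrite class_wt_nth ?(ib_size R) // sc /mu_wt (ib_muw R) -prodrXr.
rewrite [RHS]big_mkcond big_seq [RHS]big_seq; apply: eq_bigr => p.
by rewrite mem_iota /= add0n => /H ->; case: ifP.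
Qed.

Lemma fpsX_exp (R : comNzRingType) k i : (fpsX ^+ k : {fps R}) i = (i == k)%:R.
Proof.
elim: k i => [|k IH] i; first by rewrite expr0 coef_fps1.
rewrite exprS coef_fpsM; case: i => [|i].
  by rewrite big_ord1 /= mul0r.
rewrite big_ord_recl /= mul0r add0r big_ord_recl /= mul1r IH subSS subn0 big1 ?addr0 //.
by move=> j _; rewrite mul0r.
Qed.

Lemma coef_fpsXM (R : comNzRingType) k (g : {fps R}) n :
  (fpsX ^+ k * g) n = if (k <= n)%N then g (n - k)%N else 0.
Proof.
rewrite coef_fpsM; case: ifP => kn.
  have kn' : (k < n.+1)%N by [].
  rewrite (bigD1 (Ordinal kn')) //= fpsX_exp eqxx mul1r big1 ?addr0 // => i ne.
  rewrite fpsX_exp (_ : (i == k :> nat) = false) ?mul0r //.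
  by apply: contraNF ne => /eqP e; apply/eqP/val_inj.
rewrite big1 // => i _; rewrite fpsX_exp (_ : (i == k :> nat) = false) ?mul0r //.
by apply: contraFF kn => /eqP <-; rewrite -ltnS.
Qed.

Lemma sum_cays (P : pred (seq nat)) (F : seq nat -> {poly int}) n :
  \sum_(w <- cays n | P w) F w = \sum_(w in Cay n | P (word w)) F (word w).
Proof. by rewrite big_map big_enum_cond. Qed.

Lemma size_cays n w : w \in cays n -> size w = n.
Proof. by rewrite mem_cays => /andP[/eqP]. Qed.

Lemma gf_Cne : class_gf Cne = B_gf.
Proof.
apply: fpsP => n /=; rewrite big_seq_cond.
rewrite (eq_bigl (fun w => (w \in cays n) && (0 < n)%N)); last first.
  by move=> w /=; case: (boolP (w \in cays n)) => //= /size_cays ->.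
rewrite -big_seq_cond; case: ltnP => _; last by rewrite big_pred0.
by rewrite sum_cays; apply: eq_big => w; rewrite ?andbT // /mu_wt muw_word.
Qed.

Lemma gf_Cpt : class_gf Cpt = fpsX.
Proof.
apply: fpsP => n; rewrite /= -big_filter.
have -> : [seq w <- cays n | w == [:: 0%N]] = if n == 1%N then [:: [:: 0%N]] else [::].
  apply: perm_small_eq; first by case: ifP.
  apply: uniq_perm; rewrite ?filter_uniq ?cays_uniq //; first by case: ifP.
  move=> w; rewrite mem_filter mem_cays; case: eqVneq => [->|ne] /=.
    by rewrite eq_sym; case: eqP.
  by case: ifP; rewrite ?inE ?(negPf ne).
by case: ifP => _; rewrite ?big_seq1 ?big_nil.
Qed.

Lemma gf_Cind e : class_gf (Cind e) = B_gf - class_gf (Cdec e).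
Proof.
apply: fpsP => n; rewrite coef_fpsB -gf_Cne /=; apply/eqP; rewrite eq_sym subr_eq; apply/eqP.
rewrite (bigID (dec e)) /= addrC; congr (_ + _).
by apply: eq_bigl => w; rewrite andbC; case: (boolP (dec e w)) => // /dec_size /ltnW ->.
Qed.

Lemma gf_Cdec e : class_gf (Cdec e) = class_gf (Cind e) * B_gf.
Proof.
rewrite -gf_Cne; have -> : class_gf (Cind e) * class_gf Cne = \prod_(c <- [:: Cind e; Cne]) class_gf c.
  by rewrite !big_cons big_nil mulr1.
apply: fpsP => n; rewrite class_gf_prod /= -big_filter -(perm_big _ (two_perm e n)) big_map /=.
rewrite big_seq [RHS]big_seq; apply: eq_bigr => bs h.
rewrite (ib_wt (fillings_two h)) ?size_two // => p p2.
by rewrite sing_two //; case: p p2 => [|[]].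
Qed.

Lemma gf_Cdec_div e : class_gf (Cdec e) = B_gf ^+ 2 / (1 + B_gf).
Proof.
apply: (mulIr unit_1DB); rewrite divrK ?unit_1DB // mulrDr mulr1 [X in X + _]gf_Cdec gf_Cind.
by rewrite mulrBl subrK.
Qed.

Lemma prod_cls s : \prod_(c <- cls s) class_gf c = fpsX ^+ (size s - muw s) * B_gf ^+ muw s.
Proof.
rewrite big_map (bigID (sing s)) /= mulrC; congr (_ * _).
  rewrite (eq_bigr (fun=> fpsX)) => [|p /negPf ->]; last exact: gf_Cpt.
  rewrite big_const_seq iter_mulr_1; congr (_ ^+ _).
  have := count_predC (sing s) (iota 0 (size s)); rewrite size_iota -/(muw s) => e.
  by rewrite -[X in (X - _)%N]e addKn; apply: eq_count => p.
rewrite (eq_bigr (fun=> B_gf)) => [|p ->]; last exact: gf_Cne.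
by rewrite big_const_seq iter_mulr_1.
Qed.

Lemma sim_sum n : \sum_(s <- words_le Csim n) (fpsX ^+ (size s - muw s) * B_gf ^+ muw s) n =
  \sum_(w <- cays n | indec w && (3 <= size w)%N) mu_wt w.
Proof.
rewrite -[RHS]big_filter -(perm_big _ (sim_perm n)) big_allpairs_dep.
apply: eq_bigr => s _; rewrite -prod_cls class_gf_prod.
rewrite big_seq [RHS]big_seq; apply: eq_bigr => bs h.
rewrite (ib_wt (fillings_cls h)) ?size_map ?size_iota // => p ps.
by rewrite nth_map_iota //; case: ifP.
Qed.

(** * Simple words and the functional equation *)

(** For the converse, the value interval is spanned by the least and greatest letters on the
    positions. A Cayley word attains every value in between, and by [h_itv] only at positions
    inside. *)
Lemma H_intervalP n (w : {ffun 'I_n -> 'I_n}) (a b : 'I_n) : cayley w -> (a <= b)%N ->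
  reflect (h_itv (word w) a b.+1) (H_interval w (itv a b)).
Proof.
rewrite cayleyE => /caywP cw ab.
have inI (i : 'I_n) : (i \in itv a b) = (a <= i < b.+1)%N by rewrite inE ltnS.
apply: (iffP andP) => [[_ /existsP[c /existsP[d /andP[/eqP im /eqP pre]]]]|[_ _ H]].
  split; rewrite ?size_word ?ltn_ord // => x xn xout.
  have xI : Ordinal xn \notin itv a b by rewrite inI.
  have cd : (c <= d)%N.
    have : w a \in itv c d by rewrite -im imset_f // inE leqnn.
    by rewrite inE; lia.
  have yP y : (a <= y < b.+1)%N -> (c <= nth 0%N (word w) y <= d)%N.
    move=> yin; have yn : (y < n)%N by have := ltn_ord b; lia.
    have : w (Ordinal yn) \in itv c d by rewrite -im imset_f // inI.
    by rewrite inE -nth_word.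
  have xP : ~~ (c <= nth 0%N (word w) x <= d)%N.
    by move: xI; rewrite -pre !inE -nth_word.
  case: (ltnP (nth 0%N (word w) x) c) => xc; [left|right] => y /yP; lia.
split; first by apply/existsP; exists a; apply/existsP; exists b; rewrite ab eqxx.
have aI : a \in itv a b by rewrite inE leqnn.
case: (arg_minnP (fun i => w i : nat) aI) => c0 c0I cmin.
have {}c0I : c0 \in itv a b := c0I.
case: (arg_maxnP (fun i => w i : nat) aI) => d0 d0I dmax.
have {}d0I : d0 \in itv a b := d0I.
have K x : (w c0 <= w x <= w d0)%N -> x \in itv a b.
  move=> h; apply: contraT; rewrite inI => xn.
  have [] := H x; rewrite ?size_word ?ltn_ord // nth_word => h'.
    by have := h' c0; move: c0I; rewrite inI nth_word => -> /(_ isT); lia.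
  by have := h' d0; move: d0I; rewrite inI nth_word => -> /(_ isT); lia.
apply/existsP; exists (w c0); apply/existsP; exists (w d0); apply/andP; split; apply/eqP/setP => x.
  apply/imsetP/idP => [[i iI ->]|]; first by rewrite inE; apply/andP; split; [apply: cmin|apply: dmax].
  rewrite inE => h.
  have : x \in w @: [set: 'I_n].
    have wd : val (w d0) \in word w by rewrite mem_word imset_f // inE.
    rewrite -mem_word; have [_] := andP h; rewrite leq_eqVlt => /orP[/eqP e|].
      by rewrite [val x]e.
    exact: cw wd _.
  by case/imsetP => i _ e; exists i => //; apply: K; rewrite -e.
rewrite inE; apply/idP/idP => [|xI]; first by rewrite inE => /K.
by rewrite inE; apply/andP; split; [apply: cmin|apply: dmax].
Qed.

Lemma itv_full n (a b : 'I_n) : (itv a b == [set: 'I_n]) = (a == 0%N :> nat) && (b.+1 == n).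
Proof.
apply/eqP/andP => [/setP E|[/eqP a0 /eqP bn]].
  have n0 : (0 < n)%N by have := ltn_ord a; lia.
  have n1 : (n.-1 < n)%N by lia.
  have := E (Ordinal n0); have := E (Ordinal n1); rewrite !inE /= => h1 h2.
  have := ltn_ord b; lia.
by apply/setP => i; rewrite !inE; have := ltn_ord i; lia.
Qed.

Lemma itv_card1 n (a b : 'I_n) : (a <= b)%N -> (#|itv a b| == 1%N) = (b == a).
Proof.
move=> ab; apply/cards1P/eqP => [[x /setP E]|->].
  have := E a; have := E b; rewrite !inE !leqnn ab /= => /esym/eqP-> /esym/eqP->.
  by [].
exists a; apply/setP => i; rewrite !inE -(inj_eq val_inj) /=; lia.
Qed.

Lemma simple_cayE n (w : {ffun 'I_n -> 'I_n}) :
  simple_cay w = (w \in Cay n) && `[< simplew (word w) >].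
Proof.
rewrite /simple_cay; case: (boolP (w \in Cay n)) => //=; rewrite inE => cw.
apply/forallP/asboolP => [H a b h|H I].
  have [ab bn _] := h; rewrite size_word in bn.
  have an : (a < n)%N by lia.
  have bn' : (b.-1 < n)%N by lia.
  have ab' : (Ordinal an <= Ordinal bn')%N by rewrite /=; lia.
  have := H (itv (Ordinal an) (Ordinal bn')).
  have -> : H_interval w (itv (Ordinal an) (Ordinal bn')).
    by apply/H_intervalP => //=; rewrite prednK //; lia.
  rewrite itv_card1 // itv_full size_word -(inj_eq val_inj) /=.
  by case/orP; [left|right]; lia.
apply/implyP => HI; have /andP[/existsP[a /existsP[b /andP[ab /eqP E]]] _] := HI.
subst I; move/(H_intervalP cw ab): HI => /H; rewrite itv_card1 // itv_full size_word.
rewrite -(inj_eq val_inj) /=; case=> [[->]|[-> ->]]; by rewrite !eqxx ?orbT.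
Qed.

Lemma coef_S_ge3 k a : S_ge3 {poly int} k a =
  \sum_(s <- cays (a + k) | Csim.1 s && (muw s == k)) 1.
Proof.
rewrite sum_cays /=; case: ifP => ak; last first.
  by rewrite big_pred0 // => w; rewrite size_word ak !andbF.
rewrite -sum1_card natr_sum; apply: eq_big => w //.
by rewrite inE simple_cayE size_word ak andbT muw_word -andbA.
Qed.

(** The substitution groups simple words by the exponents [a] and [k] of x and y; the right-hand
    side groups them by length, which is [a + k]. *)
Lemma subst_sum n : fps_subst (S_ge3 {poly int}) B_gf n =
  \sum_(s <- words_le Csim n) (fpsX ^+ (size s - muw s) * B_gf ^+ muw s) n.
Proof.
rewrite /words_le [RHS]big_filter big_flatten big_map.
rewrite (_ : iota 0 n.+1 = index_iota 0 n.+1) ?[RHS]big_mkord; last by rewrite /index_iota subn0.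
have muS s : (muw s <= size s)%N by rewrite -[size s](size_iota 0) count_size.
pose c N k : {poly int} := \sum_(s <- cays N | Csim.1 s && (muw s == k)) 1.
transitivity (\sum_(i < n.+1) \sum_(k < n.+1) c i k * (fpsX ^+ (i - k) * B_gf ^+ k) n); last first.
  apply: eq_bigr => i _; rewrite /c.
  rewrite [LHS](eq_bigr (fun k : 'I_n.+1 => \sum_(s <- cays i | Csim.1 s && (muw s == k))
    1 * (fpsX ^+ (i - k) * B_gf ^+ k) n)) => [|k _]; last by rewrite mulr_suml.
  rewrite (exchange_big_dep Csim.1); last by move=> ? ? _ /andP[].
  rewrite big_seq_cond [RHS]big_seq_cond; apply: eq_bigr => s /andP[/size_cays si cs].
  have ms : (muw s < n.+1)%N by apply: leq_ltn_trans (muS s) _; rewrite si.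
  rewrite (bigD1 (Ordinal ms)) ?cs ?eqxx //.
  rewrite big1 ?si ?mul1r; first exact: addr0.
  by move=> k /andP[/eqP e /eqP[]]; apply: val_inj; rewrite /= e.
rewrite exchange_big.
transitivity (\sum_(k < n.+1) (S_ge3 {poly int} k * B_gf ^+ k) n) => //.
apply: eq_bigr => k _; set h := B_gf ^+ k.
have h0 m : (m < k)%N -> h m = 0 by apply: coef_fpsX_lt.
have c0 N : (N < k)%N -> c N k = 0.
  move=> Nk; rewrite /c big_seq_cond big_pred0 // => s; apply/negbTE/negP.
  by case/andP => /size_cays sN /andP[_ /eqP e]; have := muS s; rewrite e sN leqNgt Nk.
rewrite coef_fpsM -(big_mkord xpredT (fun a => S_ge3 {poly int} k a * h (n - a)%N)).
rewrite -(big_mkord xpredT (fun i => c i k * (fpsX ^+ (i - k) * h) n)).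
have kn : (k <= n.+1)%N by apply: ltnW.
(* Under [i = a + k] the ranges match up to zero terms: for [a > n - k] because B^k starts at x^k,
   and for [i < k] because a word has no more singletons than letters. *)
rewrite (@big_cat_nat _ _ _ (n.+1 - k)%N) ?leq_subr //.
rewrite [RHS](@big_cat_nat _ _ _ k) //.
rewrite -[LHS]/(_ + _) -[RHS]/(_ + _) [X in _ + X = _]big_nat_cond [X in _ + X = _]big1; last first.
  by move=> a /andP[/andP[a1 a2] _]; rewrite h0 ?mulr0 //; lia.
rewrite [X in _ = X + _]big_nat_cond [X in _ = X + _]big1 ?add0r ?addr0; last first.
  by move=> N /andP[/andP[_ Nk] _]; rewrite c0 ?mul0r.
transitivity (\sum_(0 <= a < n.+1 - k) c (a + k)%N k * (fpsX ^+ (a + k - k) * h) n); last first.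
  by rewrite -(big_addn 0 n.+1 k xpredT (fun i => c i k * (fpsX ^+ (i - k) * h) n)) add0n.
rewrite big_nat_cond [RHS]big_nat_cond.
apply: eq_bigr => a /andP[/andP[_ ak] _].
rewrite coef_S_ge3 addnK coef_fpsXM -/(c _ _) ifT //; lia.
Qed.

Lemma cays_small n : [seq w <- cays n | [&& indec w, (0 < size w)%N & (size w < 3)%N]] =
  if n == 1%N then [:: [:: 0%N]] else if n == 2 then [:: [:: 0; 0]%N] else [::].
Proof.
have ind1 : indec [:: 0%N].
  by apply/andP; split; apply/negP => /dec_size.
have ind2 : indec [:: 0%N; 0%N].
  by apply/andP; split; apply/asboolPn => -[[|[|c]] [h H]] //; have := H 0%N 1%N isT isT.
have c2 a b : cayw [:: a; b] -> indec [:: a; b] -> [:: a; b] = [:: 0; 0]%N.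
  move=> cw iw; case: (ltngtP a b) => ab.
  - by case: (@indecP _ true 1 iw); split=> // -[|x] [|[|y]].
  - by case: (@indecP _ false 1 iw); split=> // -[|x] [|[|y]].
  by move/eqP: cw; rewrite ab /std /rk /= inE eqxx /= ltnn.
apply: perm_small_eq; first by do 2!case: ifP => // _.
apply: uniq_perm; rewrite ?filter_uniq ?cays_uniq //; first by do 2!case: ifP => // _.
move=> w; rewrite mem_filter mem_cays.
have -> : (w \in if n == 1%N then [:: [:: 0%N]] else if n == 2 then [:: [:: 0; 0]%N] else [::])
   = (n == 1%N) && (w == [:: 0%N]) || (n == 2) && (w == [:: 0; 0]%N).
  by case: n => [|[|[|n]]] //=; rewrite ?inE ?orbF.
apply/andP/orP => [[/and3P[iw w0 w3] /andP[/eqP <- cw]]|].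
  case: w iw w0 w3 cw => [|a [|b []]] //= iw _ _ cw.
    by left; rewrite -(eqP cw) std_size1.
  by right; rewrite (c2 a b).
by case=> /andP[/eqP -> /eqP ->]; rewrite ?ind1 ?ind2.
Qed.

Lemma coef_tX n : (fpsC 'X * fpsX : {fps {poly int}}) n = if n == 1%N then 'X else 0.
Proof. by rewrite coef_fpsCM /=; case: eqP; rewrite ?mulr1 ?mulr0. Qed.

Lemma small_sum n : (fpsC 'X * fpsX + fpsX ^+ 2 : {fps {poly int}}) n =
  \sum_(w <- cays n | [&& indec w, (0 < size w)%N & (size w < 3)%N]) mu_wt w.
Proof.
rewrite -big_filter cays_small coef_fpsD coef_tX fpsX_exp.
have m1 : muw [:: 0%N] = 1%N.
  by rewrite /muw /= (_ : sing _ _) //; apply/asboolP => -[].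
have m2 : muw [:: 0; 0]%N = 0%N.
  have s p : (p < 2)%N -> sing [:: 0; 0]%N p = false.
    by move=> p2; apply/negbTE/singPn => //; exists (1 - p)%N; case: p p2 => [|[]].
  by rewrite /muw /= !s.
case: n => [|[|[|n]]] /=; rewrite ?big_seq1 ?big_nil /mu_wt ?m1 ?m2 ?expr1 ?expr0 ?addr0 ?add0r //.
Qed.

Theorem theorem4p4 :
  let x : {fps {poly int}} := fpsX in
  let t : {fps {poly int}} := fpsC 'X in
  B_gf = t * x + x ^+ 2 + 2 * B_gf ^+ 2 / (1 + B_gf)
         + fps_subst (S_ge3 {poly int}) B_gf.
Proof.
move=> x t; have -> : 2 * B_gf ^+ 2 / (1 + B_gf) = class_gf (Cdec true) + class_gf (Cdec false).
  by rewrite !gf_Cdec_div -mulrA mulr_natl mulr2n.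
apply: fpsP => n; rewrite -[in LHS]gf_Cne [LHS]/=.
rewrite coef_fpsD [in RHS]coef_fpsD small_sum subst_sum sim_sum coef_fpsD /=.
(* The words are sorted by kind: direct sums, then skew sums, then indecomposable words by
   length. *)
rewrite [X in _ = X + _]addrC -!addrA (bigID (dec true)) /=; congr (_ + _).
  by apply: eq_bigl => w; case: (boolP (dec true w)) => [/dec_size /ltnW ->|]; rewrite ?andbF.
rewrite (bigID (dec false)) /=; congr (_ + _).
  apply: eq_bigl => w; case: (boolP (dec false w)) => [d|]; rewrite ?andbF // (ltnW (dec_size d)).
  by rewrite andbT; apply/negP => /dec_excl; rewrite d.
rewrite (bigID (fun w => (size w < 3)%N)) /=; congr (_ + _); apply: eq_bigl => w; rewrite /indec.
  by case: dec; case: dec; rewrite ?andbF ?andbT.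
rewrite -leqNgt; case: dec; case: dec; rewrite ?andbF ?andbT //=.
by case: leqP => h; rewrite ?andbF ?andbT //; lia.
Qed.
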